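(* Let $(\Sigma,g_\Sigma)$ be a closed connected Riemannian manifold of dimension $2$ with area $|\Sigma|=1$, let $L>0$, and let $h:[0,L]\to(0,\infty)$ be a smooth function with $h(0)=h(L)=1$. Let $\sigma_j(h)$ denote the $j$-th Steklov eigenvalue of $M=[0,L]\times_h\Sigma$, that is, of $[0,L]\times\Sigma$ equipped with the Riemannian metric $g=dt^2+h(t)^2g_\Sigma$, and let $\lambda_j$ denote the $j$-th eigenvalue of the Laplacian on $(\Sigma,g_\Sigma)$. Suppose that there exist $0<L_1<L_2<L$ and a constant $c>0$ such that $h\le c$ on $[L_1,L_2]$. Then, for each $j\ge 1$, \[\sigma_j(h)\le\frac{\lambda_jL}{2}-\gamma,\] where \[\gamma=\min\left\{\frac{\lambda_j(L_2-L_1)}{4},\ \frac{3\lambda_j^2(L_2-L_1)^3}{8\left(12c^2+\lambda_j(L_2-L_1)^2\right)}\right\}.\]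
   Context: The Steklov problem on $M=[0,L]\times_h\Sigma$ is $\Delta u=0$ in $M$, $\partial_\nu u=\sigma u$ on $\partial M=\{0,L\}\times\Sigma$, where $\Delta$ is the Laplacian of $g$ and $\nu$ is the outward unit normal. Its eigenvalues, repeated according to multiplicity, are $0=\sigma_0(h)<\sigma_1(h)\le\sigma_2(h)\le\cdots\nearrow+\infty$. The eigenvalues of the (nonnegative) Laplacian on $(\Sigma,g_\Sigma)$, repeated according to multiplicity, are $0=\lambda_0<\lambda_1\le\lambda_2\le\cdots\nearrow+\infty$. *)

(* Defs.v *)
From HB Require Import structures.
From mathcomp Require Import all_boot all_order all_algebra.
From mathcomp Require Import all_classical all_reals all_analysis.

Set Implicit Arguments.
Unset Strict Implicit.
Unset Printing Implicit Defensive.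
Import Order.TTheory GRing.Theory Num.Theory.
Import numFieldNormedType.Exports.
Local Open Scope classical_set_scope.
Local Open Scope card_scope.
Local Open Scope ring_scope.

Section Smoothness.
Context {R : realType} {V W : normedModType R}.

Definition iter_derive (vs : seq V) (f : V -> W) : V -> W :=
  foldr (fun v g => 'D_v g) f vs.

(* C^infinity on an open set U (used with V and W finite-dimensional): every
   iterated directional derivative exists and is Frechet differentiable. *)
Definition Cinfty (U : set V) (f : V -> W) : Prop :=
  forall (vs : seq V) (x : V), U x -> differentiable (iter_derive vs f) x.

(* Smoothness on an arbitrary subset, in particular up to the boundary of a
   half-space: f extends smoothly to a neighbourhood of each point of A. *)
Definition smooth_on (A : set V) (f : V -> W) : Prop :=
  forall x, A x -> exists (U : set V) (F : V -> W),
    [/\ open U, U x, Cinfty U F & forall y, A y -> U y -> f y = F y].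

End Smoothness.

(* Riemannian manifold without boundary, given by a smooth atlas of charts
   [chart_map i] from the open set [dom i] onto the open set [cod i] of R^n, with
   inverse [param i], and by the Gram matrices of the metric in the charts.
   The values of [chart_map i], [param i], [gram i] off these sets are irrelevant.
   Tangent vectors are row vectors, so [gram i x] is the matrix G such that
   g(v, w) = v G w^T. *)
Record riemannianManifold (R : realType) (n : nat) := RiemannianManifold {
  carrier :> ptopologicalType;
  carrier_hausdorff : hausdorff_space carrier;
  carrier_second_countable : @second_countable carrier;
  chart : Type;
  dom : chart -> set carrier;
  cod : chart -> set 'rV[R]_n;
  chart_map : chart -> carrier -> 'rV[R]_n;
  param : chart -> 'rV[R]_n -> carrier;
  dom_open : forall i, open (dom i);
  cod_open : forall i, open (cod i);
  chart_map_cod : forall i p, dom i p -> cod i (chart_map i p);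
  param_dom : forall i x, cod i x -> dom i (param i x);
  chart_mapK : forall i p, dom i p -> param i (chart_map i p) = p;
  paramK : forall i x, cod i x -> chart_map i (param i x) = x;
  chart_map_continuous : forall i, {within dom i, continuous (chart_map i)};
  param_continuous : forall i, {within cod i, continuous (param i)};
  dom_cover : forall p, exists i, dom i p;
  transition_smooth : forall i j,
    Cinfty (cod i `&` param i @^-1` dom j) (chart_map j \o param i);
  gram : chart -> 'rV[R]_n -> 'M[R]_n;
  gram_smooth : forall i, Cinfty (cod i) (gram i);
  gram_sym : forall i x, cod i x -> (gram i x)^T = gram i x;
  gram_pos : forall i x (v : 'rV[R]_n), cod i x -> v != 0 ->
    0 < (v *m gram i x *m v^T) 0 0;
  gram_change : forall i j x, (cod i `&` param i @^-1` dom j) x ->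
    let tau : 'rV[R]_n -> 'rV[R]_n := chart_map j \o param i in
    gram i x = jacobian tau x *m gram j (tau x) *m (jacobian tau x)^T
}.

Section Laplacian.
Context {R : realType}.

(* div grad f for the metric with Gram matrices G:
   det(G)^(-1/2) sum_i d_i (det(G)^(1/2) sum_j G^{ij} d_j f). *)
Definition laplace_beltrami n (G : 'rV[R]_n -> 'M[R]_n) (f : 'rV[R]_n -> R)
    (x : 'rV[R]_n) : R :=
  (Num.sqrt (\det (G x)))^-1 *
  \sum_(i < n) 'D_(delta_mx 0 i) (fun y =>
     Num.sqrt (\det (G y)) *
     \sum_(j < n) invmx (G y) i j * 'D_(delta_mx 0 j) f y) x.

Definition laplace_eigenspace n (S : riemannianManifold R n) (lambda : R) :
    set (S -> R) :=
  [set f : S -> R | forall i : chart S,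
     Cinfty (cod i) (f \o param i) /\
     forall x, cod i x ->
       - laplace_beltrami (gram i) (f \o param i) x = lambda * f (param i x)].

End Laplacian.

Section Area.
Context {R : realType}.

Definition plane (z : R * R) : 'rV[R]_2 :=
  \row_j (if j == 0 then z.1 else z.2).

(* mu is the Riemannian area measure, on the Borel sets of S; it is uniquely
   determined since countably many of the open sets [dom i] cover S. *)
Definition is_area (S : riemannianManifold R 2)
    (mu : {measure set (g_sigma_algebraType (@open S)) -> \bar R}) : Prop :=
  forall (i : chart S) (A : set (g_sigma_algebraType (@open S))),
    measurable A -> A `<=` dom i ->
    mu A = (\int[lebesgue_measure \x lebesgue_measure]_(z in
              [set z : measurableTypeR R * measurableTypeR R |
                 cod i (plane z) /\ A (param i (plane z))])
              (Num.sqrt (\det (gram i (plane z))))%:E)%E.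

End Area.

Section Spectrum.
Context {R : realType} {T : Type}.

(* The space of restrictions to D of the functions in E has dimension n. *)
Definition has_dim (D : set T) (E : set (T -> R)) (n : nat) : Prop :=
  exists b : 'I_n -> T -> R,
    [/\ forall i, E (b i),
        forall c : 'I_n -> R,
          (forall p, D p -> \sum_i c i * b i p = 0) -> forall i, c i = 0 &
        forall f, E f -> exists c : 'I_n -> R,
          forall p, D p -> f p = \sum_i c i * b i p].

(* E x is the eigenspace of x, made of functions considered on D only; s lists
   the eigenvalues 0 = s_0 < s_1 <= s_2 <= ..., each real number x occurring
   exactly dim (E x) times. *)
Definition eigenvalues_of (D : set T) (E : R -> set (T -> R)) (s : nat -> R) :
    Prop :=
  [/\ s 0%N = 0, 0 < s 1%N,
      {homo s : j k / (j <= k)%N >-> j <= k},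
      s @ \oo --> +oo &
      forall x, exists2 n, has_dim D (E x) n & [set k | s k = x] #= `I_n].

End Spectrum.

Definition laplace_spectrum (R : realType) n (S : riemannianManifold R n)
    (lambda : nat -> R) : Prop :=
  eigenvalues_of [set: S] (laplace_eigenspace (S := S)) lambda.

Section WarpedProduct.
Context {R : realType} {n : nat}.
Variables (S : riemannianManifold R n) (L : R) (h : R -> R).

(* Coordinates on [0, L] x S are p = (t, x), with x the coordinates of a chart
   of S. *)
Definition height (p : 'rV[R]_(1 + n)) : R := lsubmx p 0 0.

Definition cylinder : set (R * S) := [set q | 0 <= q.1 <= L].

Definition cyl_cod (i : chart S) : set 'rV[R]_(1 + n) :=
  [set p | 0 <= height p <= L /\ cod i (rsubmx p)].

Definition cyl_param (i : chart S) (p : 'rV[R]_(1 + n)) : R * S :=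
  (height p, param i (rsubmx p)).

(* dt^2 + h(t)^2 g_S *)
Definition warped_gram (i : chart S) (p : 'rV[R]_(1 + n)) : 'M[R]_(1 + n) :=
  block_mx 1%:M 0 0 (h (height p) ^+ 2 *: gram i (rsubmx p)).

(* nu is the outward unit normal, in coordinates, at a point p with height p
   equal to 0 or L: unit, orthogonal to the vectors tangent to the boundary
   (those with no t-component), and pointing out of [0, L] x S. *)
Definition outward_unit_normal (i : chart S) (p nu : 'rV[R]_(1 + n)) : Prop :=
  let G := warped_gram i p in
  [/\ (nu *m G *m nu^T) 0 0 = 1,
      forall w : 'rV[R]_(1 + n), height w = 0 -> (nu *m G *m w^T) 0 0 = 0,
      height p = 0 -> height nu < 0 &
      height p = L -> 0 < height nu].

(* d is the derivative of f at p along nu, computed from inside, that is along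
   the points p - s nu with s > 0. *)
Definition inner_derivative (f : 'rV[R]_(1 + n) -> R) (p nu : 'rV[R]_(1 + n))
    (d : R) : Prop :=
  (fun s : R => s^-1 * (f p - f (p - s *: nu))) @ 0^'+ --> d.

(* The Laplace equation is imposed in the interior; by continuity it then holds
   up to the boundary. The values of u off [0, L] x S are irrelevant. *)
Definition steklov_eigenspace (sigma : R) : set (R * S -> R) :=
  [set u : R * S -> R | forall i : chart S,
     [/\ smooth_on (cyl_cod i) (u \o cyl_param i),
         forall p, cyl_cod i p -> 0 < height p < L ->
           laplace_beltrami (warped_gram i) (u \o cyl_param i) p = 0 &
         forall p nu, cyl_cod i p -> height p = 0 \/ height p = L ->
           outward_unit_normal i p nu ->
           inner_derivative (u \o cyl_param i) p nu
             (sigma * u (cyl_param i p))]].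

Definition steklov_spectrum (sigma : nat -> R) : Prop :=
  eigenvalues_of cylinder steklov_eigenspace sigma.

End WarpedProduct.

(* Main.v *)
Require Import Defs.
From HB Require Import structures.
From mathcomp Require Import all_boot all_order all_algebra.
From mathcomp Require Import all_classical all_reals all_analysis.
From mathcomp Require Import measurable_realfun ring lra.
Import Order.TTheory GRing.Theory Num.Theory.
Import numFieldNormedType.Exports.
Local Open Scope classical_set_scope.
Local Open Scope ring_scope.

(** Separation of variables: if phi is an eigenfunction of Sigma for lam, then
in dimension 2 the function a(t) phi is harmonic iff (h^2 a')' = lam a, and it
is a Steklov eigenfunction for s iff moreover h^2 a' is - s a at 0, s a at L.
For every lam >= 0 there is such a solution with a > 0 on [0, L]: s is the lower
of the two eigenvalues of the Dirichlet-to-Neumann map of the ordinary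
differential equation, whose solutions are limits of Picard iterates.
Positivity of a gives, by Picone's identity, s (f(0)^2 + f(L)^2) <= int h^2 f'^2
+ lam f^2 for all f; the bound follows by taking f = 1 off [L1, L2] with a
piecewise affine dip of the optimal depth on [L1, L2]. The second term of the
minimum gives a bound valid without restriction. Since s depends injectively on
lam, the multiplicity of s(lam) as a Steklov eigenvalue is at least that of lam,
so that the j + 1 numbers s(lambda_0), ..., s(lambda_j) yield sigma_j <= the
bound. *)

Set Implicit Arguments.
Unset Strict Implicit.
Unset Printing Implicit Defensive.

(** * Smoothness and the separated Laplacian *)

Lemma open_oo {R : realType} (x y : R) : open [set t : R | x < t < y].
Proof.
have -> : [set t | x < t < y] = [set` `]x, y[%R].
  by apply/seteqP; split=> t /=; rewrite in_itv.
exact: itv_open.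
Qed.

Lemma derive_scale1 {R : realType} (f : R -> R) (x v d : R) :
  is_derive x 1 f d -> 'D_v f x = v * d.
Proof.
move=> fd; have df : differentiable f x.
  by apply/derivable1_diffP; exact: ex_derive.
rewrite deriveE// -[in LHS](mulr1 v) -[_ * 1]/(v *: (1 : R)) linearZ.
by rewrite -deriveE// derive_val.
Qed.

(** The first-order expansion of [f] at [x] is also one of [g], and [diff_unique] then identifies
    the two differentials. *)
Lemma near_eq_differentiable {K : numFieldType} {V W : normedModType K}
    (f g : V -> W) (x : V) :
  (\near x, f x = g x) -> differentiable f x -> differentiable g x.
Proof.
move=> fg df; have gfx : g x = f x by rewrite (nbhs_singleton fg).
have gE : g \o shift x = cst (g x) + 'd f x +o_ 0 id.
  apply/eqaddoP => _/posnumP[e].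
  have /eqaddoP /(_ e%:num) /(_ [gt0 of e%:num]) := diff_locally df.
  have fg0 : \forall h \near (0 : V), f (h + x) = g (h + x).
    by move: fg; rewrite (near_shift 0) subr0.
  apply: filter_app; near=> h => /=.
  rewrite !fctE /= gfx.
  suff -> : g (h + x) = f (h + x) by [].
  by apply/esym; near: h.
have gf : 'd g x = 'd f x :> (V -> W).
  by apply: diff_unique gE; exact: diff_continuous.
by apply/diff_locallyP; split; rewrite gf//; exact: diff_continuous.
Unshelve. all: by end_near. Qed.

(** * Smoothness of finite order *)

Section Cn.
Context {R : realType} {V W : normedModType R}.

(** [Cinfty] graded by a finite order, on which to induct: the product and inverse rules, and later
    the differential equation, control order n + 1 through order n. *)
Fixpoint Cn (n : nat) (U : set V) (f : V -> W) : Prop :=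
  (forall x, U x -> differentiable f x) /\
  (if n is m.+1 then forall v, Cn m U ('D_v f) else True).

Implicit Types (U : set V) (f g : V -> W).

Lemma Cn_intro n U f : (forall x, U x -> differentiable f x) ->
  (forall m, n = m.+1 -> forall v, Cn m U ('D_v f)) -> Cn n U f.
Proof. by case: n => [|n] df Df; split=> // v; exact: Df. Qed.

Lemma Cn_differentiable n U f x : Cn n U f -> U x -> differentiable f x.
Proof. by case: n => [|n] [df _] /df. Qed.

Lemma Cn_derivable n U f x v : Cn n U f -> U x -> derivable f x v.
Proof. by move=> Uf Ux; exact/diff_derivable/(Cn_differentiable Uf). Qed.

Lemma Cn_derive n U f v : Cn n.+1 U f -> Cn n U ('D_v f).
Proof. by case=> _; apply. Qed.

Lemma CinftyP U f : Cinfty U f <-> forall n, Cn n U f.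
Proof.
split=> [Uf n|Uf vs x Ux].
  elim: n f Uf => [|n IHn] f Uf; split=> //; try exact: (Uf [::]).
  move=> v; apply: IHn => vs x Ux.
  by have := Uf (rcons vs v) x Ux; rewrite /iter_derive foldr_rcons.
suff : forall k, Cn k U (iter_derive vs f).
  by move=> /(_ 0%N) [+ _]; apply.
elim: vs => [//|v vs IHvs] k /=.
by have [_] := IHvs k.+1; apply.
Qed.

Lemma CnW n U f : Cn n.+1 U f -> Cn n U f.
Proof.
elim: n f => [|n IHn] f [df Df]; split=> // v.
by apply: IHn; exact: Df.
Qed.

Lemma CnS n U U' f : U `<=` U' -> Cn n U' f -> Cn n U f.
Proof.
move=> UU'; elim: n f => [|n IHn] f [df Df]; split=> //.
- by move=> x /UU'/df.
- by move=> x /UU'/df.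
- by move=> v; apply: IHn; exact: Df.
Qed.

(** A directional derivative depends only on the germ of the function, so agreement on an open set
    passes to all derivatives. This serves to replace a function by an explicit formula, and to glue
    local extensions. *)
Lemma Cn_local n U f :
  (forall x, U x -> exists U' F,
    [/\ open U', U' x, Cn n U' F & forall y, U' y -> f y = F y]) ->
  Cn n U f.
Proof.
have nearE (U' : set V) (F G : V -> W) x : open U' -> U' x ->
    (forall y, U' y -> F y = G y) -> \near x, G x = F x.
  by move=> oU Ux FG; apply: filterS (open_nbhs_nbhs (conj oU Ux)) => y /FG.
have diffE (U' : set V) (F G : V -> W) x m : open U' -> U' x ->
    (forall y, U' y -> F y = G y) -> Cn m U' G -> differentiable F x.
  move=> oU Ux FG CG.
  apply: (near_eq_differentiable (nearE _ _ _ _ oU Ux FG)).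
  exact: (Cn_differentiable CG).
elim: n f => [|n IHn] f lf; split=> //.
- by move=> x /lf [U' [F [oU Ux CF fF]]]; exact: diffE CF.
- by move=> x /lf [U' [F [oU Ux CF fF]]]; exact: diffE CF.
- move=> v; apply: IHn => x /lf [U' [F [oU Ux CF fF]]].
  exists U', ('D_v F); split=> //; first exact: Cn_derive.
  move=> y Uy; apply/esym/near_eq_derive.
  exact: (nearE _ _ _ _ oU Uy fF).
Qed.

Lemma Cn_eq n U f g : open U -> (forall x, U x -> f x = g x) ->
  Cn n U g -> Cn n U f.
Proof. by move=> oU fg Cg; apply: Cn_local => x Ux; exists U, g. Qed.

Lemma CnD n U f g : open U -> Cn n U f -> Cn n U g -> Cn n U (f + g).
Proof.
move=> oU; elim: n f g => [|n IHn] f g Cf Cg; apply: Cn_intro.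
- move=> x Ux; apply: differentiableD; first exact: (Cn_differentiable Cf).
  exact: (Cn_differentiable Cg).
- by [].
- move=> x Ux; apply: differentiableD; first exact: (Cn_differentiable Cf).
  exact: (Cn_differentiable Cg).
move=> m [<-] v.
have fgE x : U x -> 'D_v (f + g) x = ('D_v f + 'D_v g) x.
  move=> Ux; apply: deriveD; first exact: (Cn_derivable Cf).
  exact: (Cn_derivable Cg).
by apply: Cn_eq (oU) (fgE) _; apply: IHn; exact: Cn_derive.
Qed.

Lemma Cn_cst n U (a : W) : open U -> Cn n U (cst a).
Proof.
move=> oU; elim: n a => [|n IHn] a; apply: Cn_intro.
- by move=> x _; exact: differentiable_cst.
- by [].
- by move=> x _; exact: differentiable_cst.
move=> m [<-] v; apply: (@Cn_eq _ _ _ (cst 0)) => // x Ux.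
exact: derive_cst.
Qed.

End Cn.

Section Cn_ring.
Context {R : realType} {V : normedModType R}.
Implicit Types (U : set V) (f g : V -> R).

Lemma CnM n U f g : open U -> Cn n U f -> Cn n U g -> Cn n U (f * g).
Proof.
move=> oU; elim: n f g => [|n IHn] f g Cf Cg; apply: Cn_intro.
- move=> x Ux; apply: differentiableM; first exact: (Cn_differentiable Cf).
  exact: (Cn_differentiable Cg).
- by [].
- move=> x Ux; apply: differentiableM; first exact: (Cn_differentiable Cf).
  exact: (Cn_differentiable Cg).
move=> m [<-] v.
have fgE x : U x -> 'D_v (f * g) x = (f * 'D_v g + g * 'D_v f) x.
  move=> Ux; apply: deriveM; first exact: (Cn_derivable Cf).
  exact: (Cn_derivable Cg).
apply: Cn_eq (oU) (fgE) _; apply: CnD => //; apply: IHn.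
- exact: CnW.
- exact: Cn_derive.
- exact: CnW.
- exact: Cn_derive.
Qed.

(** The induction closes because the derivative of 1/f is - (1/f)^2 f', where 1/f occurs with no
    derivative. *)
Lemma CnV n U f : open U -> (forall x, U x -> f x != 0) ->
  Cn n U f -> Cn n U (fun x => (f x)^-1).
Proof.
move=> oU f0.
have dif k x : Cn k U f -> U x -> differentiable (fun y => (f y)^-1) x.
  move=> Cf Ux; apply: differentiableV; last exact: f0.
  exact: (Cn_differentiable Cf).
elim: n => [|n IHn] Cf; apply: Cn_intro.
- by move=> x; exact: dif Cf.
- by [].
- by move=> x; exact: dif Cf.
move=> m [<-] v; pose i := fun x => (f x)^-1.
have Ci : Cn n U i by apply/IHn/CnW.
have ifE x : U x -> 'D_v i x = (cst (-1) * (i * i) * 'D_v f) x.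
  move=> Ux; have := deriveV (f0 x Ux) (Cn_derivable Cf Ux) => ->.
  by rewrite !fctE /i expr2 invfM mulN1r.
apply: Cn_eq (oU) (ifE) _; apply: CnM => //; last exact: Cn_derive.
by apply: CnM => //; [exact: Cn_cst|exact: CnM].
Qed.

End Cn_ring.

(** The difference quotients of [f \o l] along [v] are those of [f] along [l v], so the derivatives
    agree as functions on all of [V'] and the induction applies directly. *)
Lemma Cn_comp_linear {R : realType} {V' V W : normedModType R}
    (l : V' -> V) n (U : set V) (f : V -> W) :
  linear l -> continuous l -> Cn n U f -> Cn n (l @^-1` U) (f \o l).
Proof.
move=> ll cl.
pose lM := GRing.isLinear.Build _ _ _ _ _ ll.
pose lL : {linear V' -> V} := HB.pack l lM.
have dif k g x : Cn k U g -> U (l x) -> differentiable (g \o l) x.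
  move=> Cg Ux; apply: differentiable_comp.
    exact: (@linear_differentiable _ _ _ lL).
  exact: (Cn_differentiable Cg).
elim: n f => [|n IHn] f Cf; apply: Cn_intro.
- by move=> x; exact: dif Cf.
- by [].
- by move=> x; exact: dif Cf.
move=> m [<-] v; rewrite (_ : 'D_v (f \o l) = ('D_(l v) f) \o l).
  by apply: IHn; exact: Cn_derive.
apply/funext => x; rewrite /derive /=.
apply: (congr1 (fun F : R -> W => lim (F @ 0^'))).
by apply/funext => h; rewrite /= ll.
Qed.

(* No derivability is assumed: the limit of a divergent quotient is 0 in R. *)
Lemma deriveMl_neq0 {R : realType} {V : normedModType R} (k : R) (f : V -> R)
    (x v : V) : k != 0 -> 'D_v (k \*o f) x = k * 'D_v f x.
Proof.
move=> k0; have [df|ndf] := pselect (derivable f x v); first exact: deriveMl.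
have nkdf : ~ derivable (k \*o f) x v.
  move=> dkf; apply: ndf; rewrite (_ : f = k^-1 \*: (k \*o f)).
    exact: derivableZ.
  by apply/funext => y /=; rewrite scalerA mulVf// scale1r.
have -> : 'D_v f x = point by exact: (dvgP ndf).
have -> : 'D_v (k \*o f) x = point by exact: (dvgP nkdf).
by have -> : (point : R) = 0 by []; rewrite mulr0.
Qed.

(** * Products of a function of t and a function on the chart *)

Section height.
Context {R : realType} {n : nat}.
Implicit Types p : 'rV[R]_(1 + n).

Lemma height_linear : linear (@height R n).
Proof. by move=> k p q; rewrite /height !mxE. Qed.

Lemma height_continuous : continuous (@height R n).
Proof.
move=> p; apply: (@continuous_comp _ _ _ (@lsubmx R 1 1 n) (fun M => M 0 0)).
  exact: continuous_lsubmx.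
exact: coord_continuous.
Qed.

Lemma open_product (I : set R) (U : set 'rV[R]_n) : open I -> open U ->
  open [set p : 'rV[R]_(1 + n) | I (height p) /\ U (rsubmx p)].
Proof.
move=> oI oU; apply: (@openI _ (height @^-1` I) (rsubmx @^-1` U)).
  by apply: open_comp => // p _; exact: height_continuous.
by apply: open_comp => // p _; exact: continuous_rsubmx.
Qed.

Lemma Cn_separated m (I : set R) (U : set 'rV[R]_n) (a : R -> R)
    (f : 'rV[R]_n -> R) : open I -> open U -> Cn m I a -> Cn m U f ->
  Cn m [set p : 'rV[R]_(1 + n) | I (height p) /\ U (rsubmx p)]
    (fun p => a (height p) * f (rsubmx p)).
Proof.
move=> oI oU Ca Cf; apply: CnM; first exact: open_product.
  apply: (@CnS _ _ _ _ _ (height @^-1` I)) => [p []//|].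
  exact: (Cn_comp_linear height_linear height_continuous).
apply: (@CnS _ _ _ _ _ (rsubmx @^-1` U)) => [p []//|].
apply: (Cn_comp_linear _ (@continuous_rsubmx _ _ _ _)) => //.
exact: linearP.
Qed.

Let height_lshift h p :
  height (h *: delta_mx 0 (lshift n 0) + p) = h + height p.
Proof. by rewrite /height !mxE eqxx /= mulr1. Qed.

Let rsubmx_lshift h p :
  rsubmx (h *: delta_mx 0 (lshift n 0) + p) = rsubmx p.
Proof. by apply/rowP => i; rewrite !mxE eq_rlshift andbF mulr0 add0r. Qed.

Let height_rshift h p j :
  height (h *: delta_mx 0 (rshift 1 j) + p) = height p.
Proof. by rewrite /height !mxE eq_lrshift andbF mulr0 add0r. Qed.

Let rsubmx_rshift h p j :
  rsubmx (h *: delta_mx 0 (rshift 1 j) + p) = h *: delta_mx 0 j + rsubmx p.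
Proof. by apply/rowP => i; rewrite !mxE eq_rshift. Qed.

Lemma derive_height (a : R -> R) (f : 'rV[R]_n -> R) p :
  derivable a (height p) 1 ->
  'D_(delta_mx 0 (lshift n 0)) (fun p => a (height p) * f (rsubmx p)) p =
  'D_1 a (height p) * f (rsubmx p).
Proof.
move=> da; rewrite mulrC -deriveMl// /derive.
apply: (congr1 (fun F : R -> R => lim (F @ 0^'))).
apply/funext => h /=; rewrite height_lshift rsubmx_lshift.
by rewrite [h *: 1]mulr1 ![_ * f _]mulrC.
Qed.

(** The factor [a] is constant along tangential directions. Asking that it be nonzero, rather than
    that [f] be derivable, allows [f] to be a component of the flux of an eigenfunction. *)
Lemma derive_rsubmx (a : R -> R) (f : 'rV[R]_n -> R) p j :
  a (height p) != 0 ->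
  'D_(delta_mx 0 (rshift 1 j)) (fun p => a (height p) * f (rsubmx p)) p =
  a (height p) * 'D_(delta_mx 0 j) f (rsubmx p).
Proof.
move=> a0; rewrite -deriveMl_neq0// /derive.
apply: (congr1 (fun F : R -> R => lim (F @ 0^'))).
by apply/funext => h /=; rewrite height_rshift rsubmx_rshift.
Qed.
End height.

(** * The warped Laplacian on separated functions *)

Section laplacian.
Context {R : realType}.

Lemma det_warped (k : R) n (G : 'M[R]_n) :
  \det (block_mx 1%:M 0 0 (k *: G) : 'M[R]_(1 + n)) = k ^+ n * \det G.
Proof. by rewrite det_ublock det1 mul1r detZ. Qed.

Lemma invmx_warped (k : R) n (G : 'M[R]_n) : k != 0 -> G \in unitmx ->
  invmx (block_mx 1%:M 0 0 (k *: G) : 'M[R]_(1 + n)) =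
  block_mx 1%:M 0 0 (k^-1 *: invmx G).
Proof.
move=> k0 uG; have ukG : k *: G \in unitmx.
  by rewrite unitmxE detZ unitrM unitrX ?unitfE//= -unitfE -unitmxE.
rewrite invmx_block_diag ?invmx1 ?invmxZ//.
by rewrite block_diag_mx_unit unitmx1.
Qed.

(* In dimension 2, sqrt (det (h^2 G)) = h^2 sqrt (det G) and the inverse of
   h^2 G is h^-2 G^-1, so the factors h cancel in the tangential part. *)
Lemma laplace_beltrami_separated (h a b : R -> R) (lam : R) (I : set R)
    (U : set 'rV[R]_2) (G : 'rV[R]_2 -> 'M[R]_2) (f : 'rV[R]_2 -> R)
    (p : 'rV[R]_(1 + 2)) :
  open I -> open U ->
  (forall t, I t -> [/\ h t != 0, a t != 0, is_derive t 1 a (b t / h t ^+ 2) &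
                       is_derive t 1 b (lam * a t)]) ->
  (forall x, U x -> G x \in unitmx) ->
  I (height p) -> U (rsubmx p) ->
  - laplace_beltrami G f (rsubmx p) = lam * f (rsubmx p) ->
  laplace_beltrami
    (fun q : 'rV[R]_(1 + 2) =>
       block_mx 1%:M 0 0 (h (height q) ^+ 2 *: G (rsubmx q)))
    (fun q => a (height q) * f (rsubmx q)) p = 0.
Proof.
move=> oI oU HI HU Ip Up eigf.
pose O := [set q : 'rV[R]_(1 + 2) | I (height q) /\ U (rsubmx q)].
have oO : open O by exact: open_product.
have nearO : \near p, O p by apply: open_nbhs_nbhs; split.
pose g x := Num.sqrt (\det (G x)).
have sE q : Num.sqrt (\det (block_mx 1%:M 0 0
    (h (height q) ^+ 2 *: G (rsubmx q)) : 'M[R]_(1 + 2))) =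
    h (height q) ^+ 2 * g (rsubmx q).
  by rewrite det_warped sqrtrM ?exprn_even_ge0// sqrtr_sqr ger0_norm ?sqr_ge0.
pose w i x := g x * \sum_(j < 2) invmx (G x) i j * 'D_(delta_mx 0 j) f x.
rewrite /laplace_beltrami sE big_split_ord big_ord1 /=.
pose GG (q : 'rV[R]_(1 + 2)) : 'M[R]_(1 + 2) :=
  block_mx 1%:M 0 0 (h (height q) ^+ 2 *: G (rsubmx q)).
pose flux i (q : 'rV[R]_(1 + 2)) := Num.sqrt (\det (GG q)) *
  \sum_(j < 1 + 2) invmx (GG q) i j *
    'D_(delta_mx 0 j) (fun q => a (height q) * f (rsubmx q)) q.
(* The radial flux is h^2 g a' f, and h^2 a' is [b]. *)
have -> : 'D_(delta_mx 0 (lshift 2 0)) (flux (lshift 2 0)) p =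
    'D_(delta_mx 0 (lshift 2 0)) (fun y : 'rV[R]_(1 + 2) =>
      b (height y) * (g (rsubmx y) * f (rsubmx y))) p.
  apply: near_eq_derive; apply: filterS nearO => q [Iq Uq].
  have [h0 a0 da db] := HI _ Iq.
  rewrite /flux /GG sE invmx_warped ?sqrf_eq0 ?HU// big_split_ord big_ord1 /=.
  rewrite block_mxEul mxE eqxx mul1r big1 ?addr0; last first.
    by move=> j _; rewrite block_mxEur mxE mul0r.
  rewrite derive_height; last exact: ex_derive.
  rewrite derive_val; field.
  by rewrite h0.
(* In the tangential fluxes h^2 and h^-2 cancel, which leaves [a] times the flux [w] of [f] for
   [G]. *)
have -> : \sum_(i < 2) 'D_(delta_mx 0 (rshift 1 i)) (flux (rshift 1 i)) p =
    a (height p) * \sum_(i < 2) 'D_(delta_mx 0 i) (w i) (rsubmx p).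
  rewrite big_distrr /=; apply: eq_bigr => i _.
  have [h0 a0 _ _] := HI _ Ip.
  rewrite -derive_rsubmx//.
  apply: near_eq_derive; apply: filterS nearO => q [Iq Uq].
  have {h0 a0}[h0 a0 da db] := HI _ Iq.
  rewrite /flux /GG sE invmx_warped ?sqrf_eq0 ?HU// big_split_ord big_ord1 /=.
  rewrite block_mxEdl mxE mul0r add0r /w.
  under eq_bigr do rewrite block_mxEdr mxE derive_rsubmx//.
  rewrite !big_distrr /=; apply: eq_bigr => k _; field.
  by rewrite h0.
have [h0 a0 da db] := HI _ Ip.
rewrite (derive_height (fun x => g x * f x)); last exact: ex_derive.
rewrite derive_val.
(* [G] is only known to be invertible: if its determinant is negative, [g] is 0 and so is the
   prefactor, as the inverse of 0. *)
have [g0|g0] := eqVneq (g (rsubmx p)) 0; first by rewrite g0 mulr0 invr0 mul0r.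
have : \sum_(i < 2) 'D_(delta_mx 0 i) (w i) (rsubmx p) =
    - lam * f (rsubmx p) * g (rsubmx p).
  rewrite mulNr -eigf opprK /laplace_beltrami mulrAC mulVf ?mul1r//.
move=> ->; ring.
Qed.

End laplacian.

(** * Steklov eigenfunctions from Laplace eigenfunctions *)

Section steklov.
Context {R : realType} (S : riemannianManifold R 2).
Implicit Types (L : R) (h a b : R -> R).

Lemma gram_unitmx (i : chart S) x : cod i x -> gram i x \in unitmx.
Proof.
move=> ix; rewrite unitmxE unitfE; apply/det0P => -[v v0 vG].
by have := gram_pos ix v0; rewrite vG mul0mx mxE ltxx.
Qed.

(** The metric is block diagonal. Testing orthogonality against the tangential part of [nu] itself
    shows that this part has length 0; the unit length then leaves the heights 1 and -1, and the
    outward condition chooses between them. *)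
Lemma outward_unit_normalP L h (i : chart S) (p nu : 'rV[R]_(1 + 2)) :
  0 < L -> h (height p) != 0 -> cod i (rsubmx p) ->
  height p = 0 \/ height p = L -> outward_unit_normal L h i p nu ->
  rsubmx nu = 0 /\ height nu = if height p == 0 then -1 else 1.
Proof.
move=> L0 h0 ip pL [].
have GE (w : 'rV[R]_(1 + 2)) : (nu *m warped_gram h i p *m w^T) 0 0 =
    height nu * height w +
    h (height p) ^+ 2 * (rsubmx nu *m gram i (rsubmx p) *m (rsubmx w)^T) 0 0.
  rewrite -[in LHS](hsubmxK nu) -[in LHS](hsubmxK w) /warped_gram.
  rewrite tr_row_mx mul_row_block mul_row_col !mulmx0 mulmx1 addr0 add0r.
  rewrite mxE -scalemxAr -scalemxAl [X in _ + X]mxE; congr (_ + _).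
  by rewrite mxE big_ord1 [_^T _ _]mxE.
rewrite GE => nu1 /(_ (row_mx 0 (rsubmx nu))).
have w0 : height (row_mx 0 (rsubmx nu)) = 0 by rewrite /height row_mxKl mxE.
rewrite GE w0 mulr0 add0r row_mxKr => /(_ erefl).
move=> /eqP; rewrite mulf_eq0 sqrf_eq0 (negbTE h0) /= => /eqP nuG nu0 nuL.
have nur : rsubmx nu = 0.
  apply/eqP/negPn/negP => /(gram_pos ip).
  by rewrite nuG ltxx.
split=> //; move: nu1; rewrite nuG mulr0 addr0 -expr2 => /eqP.
rewrite sqrf_eq1; case: pL => pL.
  rewrite pL eqxx => /orP[/eqP|/eqP//] nu1.
  by have := nu0 pL; rewrite nu1 ltr10.
rewrite pL (gt_eqF L0) => /orP[/eqP//|/eqP] nu1.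
by have := nuL pL; rewrite nu1 ltr0N1.
Qed.

(** Up to sign this is the difference quotient of [a] in the direction [- nu], restricted to
    positive steps. *)
Lemma cvg_inner_quotient a (x d nu : R) : is_derive x 1 a d ->
  s^-1 * (a x - a (x - s * nu)) @[s --> 0^'+] --> nu * d.
Proof.
move=> ad.
have da : differentiable a x by apply/derivable1_diffP; exact: ex_derive.
have dnu : 'D_(- nu) a x = - (nu * d) by rewrite (derive_scale1 _ ad) mulNr.
have al : (fun h : R => h^-1 *: ((a \o shift x) (h *: - nu) - a x)) @ 0^'+ -->
    - (nu * d).
  rewrite -dnu => A.
  have /cvg_ex[l al] : derivable a x (- nu) by exact: diff_derivable.
  have {l}al : (fun h : R => h^-1 *: ((a \o shift x) (h *: - nu) - a x)) @ 0^'
      --> 'D_(- nu) a x by apply/cvgP: al.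
  move=> /al /nbhs_ballP[_ /posnumP[e] xeA]; exists e%:num => //= y xey.
  by rewrite lt_def => /andP[y0 _]; exact: xeA.
rewrite -[nu * d]opprK.
apply: cvg_trans (cvgN al); apply: near_eq_cvg; near=> s.
rewrite !fctE /= -mulrN opprB; congr (_ * (_ - a _)).
by rewrite addrC -mulrN.
Unshelve. all: by end_near. Qed.

(** As h = 1 at both ends, the flux [b] is a' there, and the outward normal derivative is - b at 0
    and b at L. Smoothness of [a] on the open set [I] containing [0, L] gives smoothness up to the
    boundary. *)
Lemma steklov_separated L h a b lam s (I : set R) (phi : S -> R) :
  0 < L -> h 0 = 1 -> h L = 1 ->
  open I -> (forall t, 0 <= t <= L -> I t) -> Cinfty I a ->
  (forall t, 0 <= t <= L -> [/\ h t != 0, a t != 0,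
     is_derive t 1 a (b t / h t ^+ 2) & is_derive t 1 b (lam * a t)]) ->
  b 0 = - (s * a 0) -> b L = s * a L ->
  laplace_eigenspace lam phi ->
  steklov_eigenspace L h s (fun q : R * S => a q.1 * phi q.2).
Proof.
move=> L0 h0 hL oI LI Ca Hab b0 bL eig i.
have [Cphi eigi] := eig i.
have Hh p : height p = 0 \/ height p = L -> h (height p) = 1.
  by case=> ->.
split.
- move=> p [pL ip].
  exists [set q | I (height q) /\ cod i (rsubmx q)].
  exists (fun q => a (height q) * phi (param i (rsubmx q))); split => //.
  + by apply: open_product => //; exact: cod_open.
  + by split=> //; exact: LI.
  + apply/CinftyP => n; apply: (Cn_separated (f := phi \o param i)) => //.
    * exact: cod_open.
    * exact: ((CinftyP _ _).1 Ca).
    * exact: ((CinftyP _ _).1 Cphi).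
- move=> p [pL ip] /[dup] pL' /andP[p0 _].
  apply: (@laplace_beltrami_separated R h a b lam [set t | 0 < t < L] (cod i)
    (gram i) (phi \o param i)) => //.
  + exact: open_oo.
  + exact: cod_open.
  + by move=> t /andP[t0 tL]; apply: Hab; rewrite !ltW.
  + exact: gram_unitmx.
  + exact: eigi.
- move=> p nu [pL ip] bp onu.
  have [|nur nul] := outward_unit_normalP L0 _ ip bp onu.
    by rewrite Hh// oner_neq0.
  have [_ _ da _] := Hab _ pL.
  rewrite Hh// expr1n divr1 in da.
  have -> : s * (a (height p) * phi (param i (rsubmx p))) =
      height nu * b (height p) * phi (param i (rsubmx p)).
    rewrite mulrA; congr (_ * _); rewrite nul; case: bp => ->.
      by rewrite eqxx b0 mulN1r opprK.
    by rewrite (gt_eqF L0) bL mul1r.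
  rewrite /inner_derivative /=.
  have quo := cvgM (cvg_inner_quotient (nu := height nu) da)
    (cvg_cst (phi (param i (rsubmx p)))).
  apply: cvg_trans (quo _ _); apply: near_eq_cvg; near=> t.
  rewrite /=.
  have -> : rsubmx (p - t *: nu) = rsubmx p.
    by rewrite linearB linearZ /= nur scaler0 subr0.
  have -> : height (p - t *: nu) = height p - t * height nu.
    by rewrite /height !mxE.
  by rewrite -mulrA mulrBl.
Unshelve. all: by end_near. Qed.

End steklov.

(** * Counting eigenvalues *)

Section counting.
Local Open Scope card_scope.

(** Write the images under [Phi] of a basis of [E] in a basis of [E']. If n < m, the m by n
    coefficient matrix has a nonzero left kernel vector: a relation between the images, which the
    last hypothesis turns into a relation between the basis vectors. *)
Lemma has_dim_le {R : realType} {T T' : Type} (D : set T) (D' : set T')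
    (E : set (T -> R)) (E' : set (T' -> R)) (m n : nat)
    (Phi : (T -> R) -> T' -> R) :
  has_dim D E m -> has_dim D' E' n ->
  (forall f, E f -> E' (Phi f)) ->
  (forall k (c : 'I_k -> R) (f : 'I_k -> T -> R),
    (forall q, D' q -> \sum_i c i * Phi (f i) q = 0) ->
    forall p, D p -> \sum_i c i * f i p = 0) ->
  (m <= n)%N.
Proof.
move=> [b [Eb indb _]] [b' [_ _ spanb']] EE' PhiI.
have /choice[C HC] i : exists c : 'I_n -> R,
    forall q, D' q -> Phi (b i) q = \sum_j c j * b' j q.
  by apply/spanb'/EE'/Eb.
rewrite leqNgt; apply/negP => nm.
pose M := \matrix_(i < m, j < n) C i j.
have : kermx M != 0.
  rewrite -mxrank_eq0 mxrank_ker subn_eq0 -ltnNge.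
  exact: leq_ltn_trans (rank_leq_col M) nm.
case/rowV0Pn => v /sub_kermxP vM /eqP; apply; apply/rowP => i.
rewrite mxE; apply: (indb (v 0)); apply: PhiI => q Dq.
transitivity (\sum_j (v *m M) 0 j * b' j q); last first.
  by rewrite vM big1// => j _; rewrite mxE mul0r.
under eq_bigr do rewrite HC// big_distrr/=.
rewrite exchange_big; apply: eq_bigr => j _; rewrite mxE big_distrl.
by apply: eq_bigr => k _; rewrite mxE mulrA.
Qed.

(** By the comparison of multiplicities, the indices k with [l k = x] inject into those with
    [s k = F x]. Since [F] is injective these maps combine into one injection on 0, ..., j, whose
    values k satisfy [s k <= B]. If [s j > B], monotonicity puts them all below j, against the
    pigeonhole principle. *)
Lemma eigenvalues_of_le {R : realType} {T T' : Type} (D : set T) (D' : set T')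
    (E : R -> set (T -> R)) (E' : R -> set (T' -> R)) (l s : nat -> R)
    (F : R -> R) (B : R) (j : nat) :
  eigenvalues_of D E l -> eigenvalues_of D' E' s ->
  {in [pred x | 0 <= x] &, injective F} ->
  (forall x m n, 0 <= x -> has_dim D (E x) m -> has_dim D' (E' (F x)) n ->
    (m <= n)%N) ->
  (forall k, (k <= j)%N -> F (l k) <= B) ->
  s j <= B.
Proof.
move=> [l0 _ lhomo _ dimE] [_ _ shomo _ dimE'] Finj FE FB.
have l_ge0 k : 0 <= l k by rewrite -l0; exact: lhomo.
have /choice[G HG] x : exists g : nat -> nat, 0 <= x ->
    (forall k, l k = x -> s (g k) = F x) /\
    {in [set k | l k = x] &, injective g}.
  (* At negative [x], which is no eigenvalue, any map does. *)
  have [x0|] := boolP (0 <= x); last by exists id.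
  have [m Em mE] := dimE x; have [n En nE] := dimE' (F x).
  have mn : (m <= n)%N by exact: FE Em En.
  have : [set k | l k = x] #<= [set k | s k = F x].
    by rewrite (card_le_eql mE) (card_le_eqr nE) card_le_II.
  move=> /pcard_leP[g]; exists g => _; split.
    by move=> k lk; have := 'funS_g lk.
  exact: 'inj_g.
rewrite leNgt; apply/negP => Bs.
have GP k : s (G (l k) k) = F (l k) by have [+ _] := HG _ (l_ge0 k); apply.
have Gj (k : 'I_j.+1) : (G (l k) k < j)%N.
  rewrite ltnNge; apply/negP => /shomo; apply/negP; rewrite -ltNge GP.
  by rewrite (le_lt_trans _ Bs)// FB// -ltnS.
pose g (k : 'I_j.+1) : 'I_j := Ordinal (Gj k).
have ginj : injective g.
  move=> k k' [] GE; have lE : l k = l k'.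
    by apply: Finj; rewrite ?inE// -!GP GE.
  apply: val_inj; have [_] := HG _ (l_ge0 k).
  by apply; rewrite ?inE//= GE lE.
by have := leq_card _ ginj; rewrite !card_ord ltnn.
Qed.

End counting.

(** * Positive solutions of the radial equation *)

Section is_derive1.
Context {R : realType}.
Implicit Types (f g : R -> R) (x c df dg : R).

Lemma is_derive1_cst c x : is_derive x 1 (fun=> c) 0.
Proof. exact: is_derive_cst. Qed.

Lemma is_derive1_id x : is_derive x 1 (fun t : R => t) 1.
Proof. exact: is_derive_id. Qed.

Lemma is_derive1D f g x df dg : is_derive x 1 f df -> is_derive x 1 g dg ->
  is_derive x 1 (fun t => f t + g t) (df + dg).
Proof. by move=> ? ?; exact: is_deriveD. Qed.

Lemma is_derive1N f x df : is_derive x 1 f df ->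
  is_derive x 1 (fun t => - f t) (- df).
Proof. by move=> ?; exact: is_deriveN. Qed.

Lemma is_derive1M f g x df dg : is_derive x 1 f df -> is_derive x 1 g dg ->
  is_derive x 1 (fun t => f t * g t) (f x * dg + g x * df).
Proof. by move=> ? ?; exact: is_deriveM. Qed.

Lemma is_derive1V f x df : f x != 0 -> is_derive x 1 f df ->
  is_derive x 1 (fun t => (f t)^-1) (- (f x) ^- 2 * df).
Proof.
move=> fx0 fdf; split; first by apply: derivableV => //; exact: ex_derive.
by rewrite deriveV// derive_val.
Qed.

Lemma MVT_is_derive f f' (x y : R) : x <= y ->
  (forall t, x <= t <= y -> is_derive t 1 f (f' t)) ->
  exists2 c, x <= c <= y & f y - f x = f' c * (y - x).
Proof.
move=> xy ff'.
have [t||c cxy ->] := @MVT_segment R f f' x y xy.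
- by rewrite in_itv /= => /andP[? ?]; apply: ff'; rewrite !ltW.
- apply: derivable_within_continuous => t; rewrite in_itv /= => /ff' ?.
  exact: ex_derive.
- by exists c.
Qed.

Lemma ler_is_derive f f' (x y : R) : x <= y ->
  (forall t, x <= t <= y -> is_derive t 1 f (f' t)) ->
  (forall t, x <= t <= y -> 0 <= f' t) -> f x <= f y.
Proof.
move=> xy ff' f'0; have [c /f'0 f'c fE] := MVT_is_derive xy ff'.
by rewrite -subr_ge0 fE mulr_ge0// subr_ge0.
Qed.

Lemma ltr_is_derive f f' (x y : R) : x < y ->
  (forall t, x <= t <= y -> is_derive t 1 f (f' t)) ->
  (forall t, x <= t <= y -> 0 < f' t) -> f x < f y.
Proof.
move=> xy ff' f'0; have [c /f'0 f'c fE] := MVT_is_derive (ltW xy) ff'.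
by rewrite -subr_gt0 fE mulr_gt0// subr_gt0.
Qed.

End is_derive1.

(* [apply] would trigger a costly type class search on the class [is_derive]. *)
Ltac is_derive1 := first
  [ notypeclasses refine (@is_derive1_cst _ _ _)
  | notypeclasses refine (@is_derive1_id _ _)
  | eassumption
  | lazymatch goal with
    | |- is_derive _ _ (fun t => @?f t + @?g t) _ =>
      notypeclasses refine (@is_derive1D _ f g _ _ _ _ _); is_derive1
    | |- is_derive _ _ (fun t => - @?f t) _ =>
      notypeclasses refine (@is_derive1N _ f _ _ _); is_derive1
    | |- is_derive _ _ (fun t => @?f t * @?g t) _ =>
      notypeclasses refine (@is_derive1M _ f g _ _ _ _ _); is_derive1
    | |- is_derive _ _ (fun t => (@?f t)^-1) _ =>
      notypeclasses refine (@is_derive1V _ f _ _ _ _); [|is_derive1]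
    end ].

Ltac is_derive1_eq :=
  notypeclasses refine (@is_derive_eq _ _ _ _ _ _ _ _ _ _);
    [is_derive1|cbv beta].

(** * Picone's identity and the upper bound *)

Section riccati.
Context {R : realType}.
Implicit Types (h a b : R -> R).

(* Picone's identity: with f affine of slope k,
   (f^2 b / a)' = lam f^2 + h^2 k^2 - (h k - f b / (h a))^2. *)
Lemma picone_segment h a b (lam x y u k C : R) : x <= y ->
  (forall t, x <= t <= y -> [/\ 0 < h t, 0 < a t,
     is_derive t 1 a (b t / h t ^+ 2) & is_derive t 1 b (lam * a t)]) ->
  (forall t, x <= t <= y -> h t ^+ 2 * k ^+ 2 <= C) ->
  b y / a y * (u + k * (y - x)) ^+ 2 - b x / a x * u ^+ 2 <=
  lam * (u ^+ 2 * (y - x) + u * k * (y - x) ^+ 2 + k ^+ 2 / 3 * (y - x) ^+ 3) +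
    C * (y - x).
Proof.
move=> xy Hab hC.
pose f t := u + k * (t - x).
(* This is the integral of lam f^2 + C from x to t, minus f^2 b / a. By Picone's identity its
   derivative is C - h^2 k^2 plus a square. *)
pose P t := lam * (u ^+ 2 * (t - x) + u * k * ((t - x) * (t - x)) +
  k ^+ 2 / 3 * ((t - x) * (t - x) * (t - x))) + C * (t - x) -
  b t * (a t)^-1 * (f t * f t).
have : P x <= P y.
  apply: (@ler_is_derive _ P (fun t => C - h t ^+ 2 * k ^+ 2 +
      (h t * k - f t * b t / (h t * a t)) ^+ 2)) => [|t txy|t txy].
  - exact: xy.
  - have [h0 a0 da db] := Hab _ txy.
    rewrite /P /f.
    have [hn an] := (lt0r_neq0 h0, lt0r_neq0 a0).
    by is_derive1_eq; [|field; rewrite hn an].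
  - by rewrite addr_ge0 ?sqr_ge0// subr_ge0 hC.
rewrite /P /f !subrr; lra.
Qed.

End riccati.

Section steklov_mode.
Context {R : realType}.
Implicit Types (h a b : R -> R).

(* If phi is a Laplace eigenfunction for lam, then a(t) phi is a Steklov
   eigenfunction for s; b is the flux h^2 a'. *)
Record positive_mode h (L lam s : R) a b : Prop := PositiveMode {
  mode_ode : forall t, 0 <= t <= L -> [/\ 0 < h t, 0 < a t,
     is_derive t 1 a (b t / h t ^+ 2) & is_derive t 1 b (lam * a t)];
  mode_at0 : b 0 = - (s * a 0);
  mode_atL : b L = s * a L }.

(** The test function is 1 off [L1, L2] and falls linearly to 1 - m at the midpoint M. The separate
    [mu] lets the eigenvalues of index at most j all be bounded in terms of the j-th one. *)
Lemma mode_bound h a b (L lam mu s L1 L2 c : R) :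
  0 < L1 -> L1 < L2 -> L2 < L -> 0 < c ->
  (forall t, L1 <= t <= L2 -> h t <= c) ->
  0 <= lam -> lam <= mu -> positive_mode h L lam s a b ->
  s <= mu * L / 2 - 3 * mu ^+ 2 * (L2 - L1) ^+ 3 /
         (8 * (12 * c ^+ 2 + mu * (L2 - L1) ^+ 2)).
Proof.
move=> L1_gt0 L12 L2L c0 hc lam0 lammu [ode b0 bL].
pose d := L2 - L1; have d0 : 0 < d by rewrite subr_gt0.
pose e := d / 2; pose M := L1 + e.
have e0 : 0 < e by rewrite divr_gt0.
have L2M : L2 - M = e by rewrite /M /e /d; field.
have mu0 : 0 <= mu by exact: le_trans lammu.
pose den := 12 * c ^+ 2 + mu * d ^+ 2.
have den0 : 0 < den.
  by apply: ltr_wpDr; [rewrite mulr_ge0 ?sqr_ge0|rewrite mulr_gt0 ?exprn_gt0].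
(* The depth minimising mu (L - d m + d m^2 / 3) + 4 c^2 m^2 / d. It may exceed 1; the test function
   then changes sign, which Picone's identity allows. *)
pose m := 3 * mu * d ^+ 2 / (2 * den).
have ode' x y : 0 <= x -> y <= L -> forall t, x <= t <= y ->
    [/\ 0 < h t, 0 < a t, is_derive t 1 a (b t / h t ^+ 2)
      & is_derive t 1 b (lam * a t)].
  move=> x0 yL t /andP[xt ty]; apply: ode.
  by rewrite (le_trans x0 xt) (le_trans ty yL).
have hk x y k : L1 <= x -> y <= L2 -> forall t, x <= t <= y ->
    h t ^+ 2 * k ^+ 2 <= c ^+ 2 * k ^+ 2.
  move=> x0 yL t /andP[xt ty]; rewrite ler_wpM2r ?sqr_ge0//.
  have tL : L1 <= t <= L2 by rewrite (le_trans x0 xt) (le_trans ty yL).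
  have tL' : 0 <= t <= L by case/andP: tL => ? ?; apply/andP; split; lra.
  have [ht _ _ _] := ode _ tL'.
  by rewrite ler_sqr ?nnegrE ?hc// ltW.
(* On the two flat pieces the slope is 0, so the gradient term vanishes whatever the size of h. *)
have h0 x y : forall t, x <= t <= y -> h t ^+ 2 * 0 ^+ 2 <= 0.
  by move=> t _; rewrite expr0n mulr0.
have L1M : L1 <= M by rewrite lerDl ltW.
have ML2 : M <= L2 by rewrite -subr_ge0 L2M ltW.
have L1_ge0 := ltW L1_gt0; have L2_leL := ltW L2L.
have M0 : 0 <= M by exact: le_trans L1M.
have ML : M <= L by exact: le_trans L2_leL.
have L1L : L1 <= L by exact: le_trans ML.
have L20 : 0 <= L2 by exact: le_trans ML2.
have s1 := @picone_segment R h a b lam 0 L1 1 0 0 L1_ge0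
  (ode' 0 L1 (lexx _) L1L) (h0 _ _).
have s2 := @picone_segment R h a b lam L1 M 1 (- m / e) _ L1M
  (ode' _ _ L1_ge0 ML) (hk _ _ _ (lexx _) ML2).
have s3 := @picone_segment R h a b lam M L2 (1 - m) (m / e) _ ML2
  (ode' _ _ M0 L2_leL) (hk _ _ _ L1M (lexx _)).
have s4 := @picone_segment R h a b lam L2 L 1 0 0 L2_leL
  (ode' _ _ L20 (lexx _)) (h0 _ _).
have ML1 : M - L1 = e by rewrite /M addrC addKr.
have en := lt0r_neq0 e0.
rewrite ML1 in s2; rewrite L2M in s3.
have [_ a00 _ _] := ode 0 (introT andP (conj (lexx 0) (le_trans L1_ge0 L1L))).
have [_ aL0 _ _] := ode L (introT andP (conj (le_trans L1_ge0 L1L) (lexx L))).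
have w0 : b 0 / a 0 = - s by rewrite b0 mulNr mulfK// lt0r_neq0.
have wL : b L / a L = s by rewrite bL mulfK// lt0r_neq0.
have fM : 1 + - m / e * e = 1 - m by field.
have fL2 : 1 - m + m / e * e = 1 by field.
rewrite fM in s2; rewrite fL2 in s3; rewrite w0 in s1; rewrite wL in s4.
have s2' : b M / a M * (1 - m) ^+ 2 - b L1 / a L1 <=
    lam * (e * (1 - m + m ^+ 2 / 3)) + c ^+ 2 * m ^+ 2 / e.
  by move: s2; rewrite expr1n mulr1 => /le_trans; apply; rewrite le_eqVlt;
    apply/orP; left; apply/eqP; field.
have s3' : b L2 / a L2 - b M / a M * (1 - m) ^+ 2 <=
    lam * (e * (1 - m + m ^+ 2 / 3)) + c ^+ 2 * m ^+ 2 / e.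
  by move: s3; rewrite expr1n mulr1 => /le_trans; apply; rewrite le_eqVlt;
    apply/orP; left; apply/eqP; field.
(* The boundary terms at L1, M and L2 telescope; those at 0 and L contribute s each. *)
have sum : 2 * s <= lam * (L - d + d * (1 - m + m ^+ 2 / 3)) +
    2 * (c ^+ 2 * m ^+ 2 / e).
  move: s1 s2' s3' s4; rewrite /M /e /d; lra.
have coef0 : 0 <= L - d + d * (1 - m + m ^+ 2 / 3).
  rewrite addr_ge0 ?mulr_ge0// ?ltW//; first by rewrite /d; lra.
  (* 1 - m + m^2 / 3 = ((m - 3/2)^2 + 3/4) / 3. The sign of this coefficient permits replacing [lam]
     by [mu]. *)
  have := sqr_ge0 (m - 3 / 2); lra.
have : 2 * s <= mu * (L - d + d * (1 - m + m ^+ 2 / 3)) +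
    2 * (c ^+ 2 * m ^+ 2 / e).
  by apply: le_trans sum _; rewrite lerD2r ler_wpM2r.
rewrite -/d -/den /e.
have -> : mu * (L - d + d * (1 - m + m ^+ 2 / 3)) +
    2 * (c ^+ 2 * m ^+ 2 / (d / 2)) =
    2 * (mu * L / 2 - 3 * mu ^+ 2 * d ^+ 3 / (8 * den)).
  rewrite /m; move: (lt0r_neq0 den0) (lt0r_neq0 d0); rewrite /den => dn0 d0'.
  by field; rewrite dn0 d0'.
by rewrite ler_pM2l.
Qed.

(** The Wronskian [a * b' - b * a'] of the two modes has derivative (lam' - lam) times the positive
    product of [a] and [a'], while the boundary conditions with a common [s] make it vanish at both
    ends. *)
Lemma mode_inj h a b a' b' (L lam lam' s : R) : 0 < L ->
  positive_mode h L lam s a b -> positive_mode h L lam' s a' b' -> lam = lam'.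
Proof.
move=> L0.
wlog ll : lam lam' a b a' b' / lam < lam'.
  move=> W P P'; have [ll|ll|//] := ltgtP lam lam'; first exact: W ll P P'.
  exact/esym/(W _ _ _ _ _ _ ll P' P).
move=> [ode b0 bL] [ode' b0' bL'].
have L_ge0 := ltW L0.
have : a 0 * b' 0 - b 0 * a' 0 < a L * b' L - b L * a' L.
  apply: (@ltr_is_derive R (fun t => a t * b' t - b t * a' t)
    (fun t => (lam' - lam) * (a t * a' t))) => [|t tL|t tL].
  - exact: L0.
  - have [h0 a0 da db] := ode _ tL; have [_ a0' da' db'] := ode' _ tL.
    have hn := lt0r_neq0 h0.
    by is_derive1_eq; field.
  - have [_ a0 _ _] := ode _ tL; have [_ a0' _ _] := ode' _ tL.
    by rewrite !mulr_gt0// subr_gt0.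
by rewrite b0 b0' bL bL' ltNge; case/negP; lra.
Qed.

End steklov_mode.

(** * Existence of positive solutions *)

Section linear_ode.
Context {R : realType}.
Notation mu := (@lebesgue_measure R).
Implicit Types (f p a b : R -> R) (l u : R).

Lemma within_continuousM (A : set R) f g : {within A, continuous f} ->
  {within A, continuous g} -> {within A, continuous (fun t => f t * g t)}.
Proof. by move=> cf cg x; apply: continuousM; [exact: cf|exact: cg]. Qed.

Lemma within_continuousD (A : set R) f g : {within A, continuous f} ->
  {within A, continuous g} -> {within A, continuous (fun t => f t + g t)}.
Proof. by move=> cf cg x; apply: continuousD; [exact: cf|exact: cg]. Qed.

Lemma within_continuousB (A : set R) f g : {within A, continuous f} ->
  {within A, continuous g} -> {within A, continuous (fun t => f t - g t)}.
Proof. by move=> cf cg x; apply: continuousB; [exact: cf|exact: cg]. Qed.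

Lemma within_continuous_cst (A : set R) (c : R) :
  {within A, continuous (fun=> c)}.
Proof. by move=> x; exact: cst_continuous. Qed.

Lemma continuous_integrable f l u t : t <= u ->
  {within `[l, u], continuous f} ->
  mu.-integrable `[l, t] (EFin \o f).
Proof.
move=> tu cf.
apply: continuous_compact_integrable; first exact: segment_compact.
by apply: continuous_subspaceW cf; apply: subset_itvl; rewrite bnd_simp.
Qed.

(** The derivative is two-sided, hence stated in the interior only. For this reason the equation is
    later solved on an interval larger than [0, L]. *)
Lemma antiderivative f l u : l < u -> {within `[l, u], continuous f} ->
  let F t := \int[mu]_(x in `[l, t]) f x in
  [/\ F l = 0, {within `[l, u], continuous F} &
      forall t, l < t < u -> is_derive t 1 F (f t)].
Proof.
move=> lu cf F; have intf := continuous_integrable (lexx u) cf.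
split.
- by rewrite /F set_itv1 Rintegral_set1.
- exact: parameterized_integral_continuous (ltW lu) intf.
- move=> t /andP[lt tu].
  have cft : {for t, continuous f}.
    by apply: within_continuous_continuous lu cf _; rewrite in_itv /= lt.
  have [dF FE] := continuous_FTC1_closed tu intf lt cft.
  by split; [exact: dF|rewrite -FE derive1E].
Qed.


(** Dominated convergence with a constant bound. The limit inherits measurability from the
    continuous [f_ n]; its integrability will make its primitive continuous. *)
Lemma cvg_Rintegral_bounded (f_ : nat -> R -> R) f l t (M : R) :
  (forall n, {within `[l, t], continuous (f_ n)}) ->
  (forall n x, l <= x <= t -> `|f_ n x| <= M) ->
  (forall x, l <= x <= t -> f_ ^~ x @ \oo --> f x) ->
  mu.-integrable `[l, t] (EFin \o f) /\
  \int[mu]_(x in `[l, t]) f_ n x @[n --> \oo] --> \int[mu]_(x in `[l, t]) f x.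
Proof.
move=> cf fM ff.
have mf_ n := measurable_int _ (continuous_integrable (lexx t) (cf n)).
have cvgf x : `[l, t]%classic x ->
    (EFin \o f_ n) x @[n --> \oo] --> (EFin \o f) x.
  by rewrite /= in_itv /= => /ff fx; apply: cvg_EFin => //; near=> n.
have mf := emeasurable_fun_cvg _ _ mf_ cvgf.
have iM := continuous_integrable (lexx t) (@within_continuous_cst `[l, t] M).
have fM' x n : `[l, t]%classic x ->
    (`|(EFin \o f_ n) x| <= (EFin \o (fun=> M)) x)%E.
  by rewrite /= in_itv /= => /(fM n); rewrite lee_fin.
have [intf _ cvgint] := @dominated_convergence _ _ R mu `[l, t]
  (measurable_itv _) _ _ _ mf_ mf
  (aeW mu cvgf) iM (aeW mu fM').
split => //.
apply: fine_cvg; rewrite fineK//; exact: integrable_fin_num.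
Unshelve. all: by end_near. Qed.


Lemma le_of_is_derive f g (f' g' : R -> R) l u t :
  {within `[l, u], continuous f} -> {within `[l, u], continuous g} ->
  (forall s, l < s < u ->
    [/\ is_derive s 1 f (f' s), is_derive s 1 g (g' s) & f' s <= g' s]) ->
  f l <= g l -> l <= t <= u -> f t <= g t.
Proof.
move=> cf cg fg fgl /andP[]; rewrite le_eqVlt => /predU1P[<-//|lt tu].
pose k x := g x + - f x.
have ck : {within `[l, t], continuous k}.
  apply: (@continuous_subspaceW _ _ _ `[l, u]).
    by apply: subset_itvl; rewrite bnd_simp.
  exact: (within_continuousB cg cf).
have lxu x : x \in `]l, t[ -> l < x < u.
  by rewrite in_itv /= => /andP[-> /= /lt_le_trans]; apply.
have [x /lxu/fg[df dg _]|c /lxu/fg[_ _ cfg] kE] :=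
  @MVT R k (fun x => g' x + - f' x) l t lt _ ck.
  by rewrite /k; is_derive1.
rewrite -subr_ge0 -[_ - _]/(k t) -(subrK (k l) (k t)) kE.
by rewrite addr_ge0 ?mulr_ge0// subr_ge0// ltW.
Qed.

(* The coefficients and the initial data are nonnegative, so that the iterates
   increase with n and are bounded by the exponential of Gronwall's lemma. *)
Section picard.
Variables (p : R -> R) (l u lam al be C : R).
Hypothesis lu : l < u.
Hypothesis cp : {within `[l, u], continuous p}.
Hypothesis p0 : forall t, l <= t <= u -> 0 <= p t <= C.
Hypothesis lam0 : 0 <= lam <= C.
Hypothesis al0 : 0 <= al.
Hypothesis be0 : 0 <= be.

(** Iterates for a' = p b, b' = lam a with data (al, be) at l. They start at (0, 0) instead of the
    data, so that the first monotonicity step is the nonnegativity of the next iterate. *)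
Fixpoint picard (n : nat) : (R -> R) * (R -> R) :=
  if n is m.+1 then
    (fun t => al + \int[mu]_(x in `[l, t]) (p x * (picard m).2 x),
     fun t => be + \int[mu]_(x in `[l, t]) (lam * (picard m).1 x))
  else (fun=> 0, fun=> 0).

Arguments picard : simpl never.

Let picardS1 n t : (picard n.+1).1 t =
  al + \int[mu]_(x in `[l, t]) (p x * (picard n).2 x).
Proof. by []. Qed.

Let picardS2 n t : (picard n.+1).2 t =
  be + \int[mu]_(x in `[l, t]) (lam * (picard n).1 x).
Proof. by []. Qed.

Lemma continuous_picard n : {within `[l, u], continuous (picard n).1} /\
  {within `[l, u], continuous (picard n).2}.
Proof.
elim: n => [|n [ca cb]]; first by split; exact: within_continuous_cst.
have [_ ci _] := antiderivative lu (within_continuousM cp cb).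
have [_ ci' _] := antiderivative lu
  (within_continuousM (@within_continuous_cst `[l, u] lam) ca).
split; first exact: (within_continuousD (@within_continuous_cst _ al) ci).
exact: (within_continuousD (@within_continuous_cst _ be) ci').
Qed.

Let continuous_pb n :
  {within `[l, u], continuous (fun x => p x * (picard n).2 x)}.
Proof. exact: within_continuousM cp (continuous_picard n).2. Qed.

Let continuous_la n :
  {within `[l, u], continuous (fun x => lam * (picard n).1 x)}.
Proof.
have [ca _] := continuous_picard n.
exact: within_continuousM (@within_continuous_cst _ lam) ca.
Qed.

Lemma picard_ge0 n t : l <= t <= u ->
  0 <= (picard n).1 t /\ 0 <= (picard n).2 t.
Proof.
elim: n t => [//|n IHn] t /andP[lt tu]; 
  split; rewrite ?(picardS1, picardS2) addr_ge0//.
  apply: Rintegral_ge0 => x /=; rewrite in_itv /= => /andP[lx xt].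
  have lxu : l <= x <= u by rewrite lx (le_trans xt).
  by rewrite mulr_ge0//; [case/andP: (p0 lxu)|case: (IHn _ lxu)].
apply: Rintegral_ge0 => x /=; rewrite in_itv /= => /andP[lx xt].
have lxu : l <= x <= u by rewrite lx (le_trans xt).
by rewrite mulr_ge0//; [case/andP: lam0|case: (IHn _ lxu)].
Qed.

Lemma picard_le n t : l <= t <= u ->
  (picard n).1 t <= (picard n.+1).1 t /\ (picard n).2 t <= (picard n.+1).2 t.
Proof.
elim: n t => [|n IHn] t ltu; first exact: (picard_ge0 1 ltu).
case/andP: ltu => lt tu.
have int1 m := continuous_integrable tu (@continuous_pb m).
have int2 m := continuous_integrable tu (@continuous_la m).
split; rewrite ?(picardS1, picardS2) lerD2l.
  apply: le_Rintegral; first exact: measurable_itv.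
  - exact: int1.
  - exact: int1.
  move=> x /=; rewrite in_itv /= => /andP[lx xt].
  have lxu : l <= x <= u by rewrite lx (le_trans xt).
  by rewrite ler_wpM2l//; [case/andP: (p0 lxu)|case: (IHn _ lxu)].
apply: le_Rintegral; first exact: measurable_itv.
- exact: int2.
- exact: int2.
move=> x /=; rewrite in_itv /= => /andP[lx xt].
have lxu : l <= x <= u by rewrite lx (le_trans xt).
by rewrite ler_wpM2l//; [case/andP: lam0|case: (IHn _ lxu)].
Qed.

Let E (t : R) := (al + be) * expR (C * (t + - l)).

Let dE (t : R) : is_derive t 1 E (C * E t).
Proof.
have de : is_derive t 1 (fun s => expR (C * (s + - l)))
    (expR (C * (t + - l)) * C).
  apply: (@is_derive1_comp _ expR (fun s => C * (s + - l))).
  by is_derive1_eq; ring.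
by rewrite /E; is_derive1_eq; rewrite /E; ring.
Qed.

(** [E] satisfies E' = C E and E(l) = al + be, so it dominates both data; as [p] and [lam] are at
    most [C], a bound by [E] for one iterate bounds the derivatives of the next by C E. *)
Lemma picard_bound n t : l <= t <= u ->
  (picard n).1 t <= E t /\ (picard n).2 t <= E t.
Proof.
have E0 s : 0 <= E s by rewrite mulr_ge0 ?addr_ge0 ?expR_ge0.
have cE : {within `[l, u], continuous E}.
  apply: derivable_within_continuous => s _; by case: (dE s).
have El : E l = al + be by rewrite /E subrr mulr0 expR0 mulr1.
elim: n t => [|n IHn] t ltu; first by split; exact: E0.
have [ca cb] := continuous_picard n.+1.
have [_ _ da] := antiderivative lu (@continuous_pb n).
have [_ _ db] := antiderivative lu (@continuous_la n).
have [al' _ _] := antiderivative lu (@continuous_pb n).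
have [bl' _ _] := antiderivative lu (@continuous_la n).
split.
  apply: (le_of_is_derive (f' := fun s => p s * (picard n).2 s)
    (g' := fun s => C * E s) ca cE _ _ ltu).
    move=> s lsu.
    have lsu' : l <= s <= u by case/andP: lsu => ? ?; rewrite !ltW.
    split; [|exact: dE|].
      have := is_derive1D (is_derive1_cst al s) (da _ lsu).
      by rewrite add0r.
    have [/andP[ps pC] [_ bE]] := (p0 lsu', IHn _ lsu').
    by rewrite ler_pM//; case: (picard_ge0 n lsu').
  by rewrite picardS1 al' addr0 El lerDl.
apply: (le_of_is_derive (f' := fun s => lam * (picard n).1 s)
  (g' := fun s => C * E s) cb cE _ _ ltu).
  move=> s lsu; have lsu' : l <= s <= u by case/andP: lsu => ? ?; rewrite !ltW.
  split; [|exact: dE|].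
    have := is_derive1D (is_derive1_cst be s) (db _ lsu).
    by rewrite add0r.
  have [/andP[ps pC] [aE _]] := (lam0, IHn _ lsu').
  by rewrite ler_pM//; case: (picard_ge0 n lsu').
by rewrite picardS2 bl' addr0 El lerDr.
Qed.


Let cvg_picard t : l <= t <= u ->
  (picard n).1 t @[n --> \oo] --> limn (fun n => (picard n).1 t) /\
  (picard n).2 t @[n --> \oo] --> limn (fun n => (picard n).2 t).
Proof.
move=> ltu.
split; apply: nondecreasing_is_cvgn.
- by apply/nondecreasing_seqP => n; case: (picard_le n ltu).
- by exists (E t) => _ [n _ <-]; case: (picard_bound n ltu).
- by apply/nondecreasing_seqP => n; case: (picard_le n ltu).
- by exists (E t) => _ [n _ <-]; case: (picard_bound n ltu).
Qed.

(** The monotone limits of the iterates satisfy the integral equations by dominated convergence, and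
    these give regularity. *)
Lemma linear_ode : exists a b : R -> R,
  [/\ a l = al, b l = be, {within `[l, u], continuous a},
      {within `[l, u], continuous b} &
      forall t, l <= t <= u -> [/\ 0 <= a t, 0 <= b t &
        l < t < u -> is_derive t 1 a (p t * b t) /\
                     is_derive t 1 b (lam * a t)]].
Proof.
pose alim t := limn (fun n => (picard n).1 t).
pose blim t := limn (fun n => (picard n).2 t).
have C0 : 0 <= C by case/andP: lam0 => /le_trans; apply.
have EE t : l <= t <= u -> E t <= E u.
  case/andP=> _ tu; rewrite ler_wpM2l ?addr_ge0// ler_expR ler_wpM2l//.
  by rewrite lerD2r.
have sub t x : l <= t <= u -> l <= x <= t -> l <= x <= u.
  by case/andP=> _ tu /andP[-> /le_trans]; apply.
have subW t f : l <= t <= u -> {within `[l, u], continuous f} ->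
    {within `[l, t], continuous f}.
  move=> /andP[_ tu]; apply: continuous_subspaceW.
  by apply: subset_itvl; rewrite bnd_simp.
have bound1 t n x : l <= t <= u -> l <= x <= t ->
    `|p x * (picard n).2 x| <= C * E u.
  move=> ltu /(sub _ _ ltu) lxu; have [_ p2] := picard_ge0 n lxu.
  have /andP[px pC] := p0 lxu; have [_ pE] := picard_bound n lxu.
  by rewrite ger0_norm ?mulr_ge0// ler_pM// (le_trans pE)// EE.
have bound2 t n x : l <= t <= u -> l <= x <= t ->
    `|lam * (picard n).1 x| <= C * E u.
  move=> ltu /(sub _ _ ltu) lxu; have [p1 _] := picard_ge0 n lxu.
  have /andP[px pC] := lam0; have [pE _] := picard_bound n lxu.
  by rewrite ger0_norm ?mulr_ge0// ler_pM// (le_trans pE)// EE.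
have lim1 t : l <= t <= u ->
    mu.-integrable `[l, t] (EFin \o (fun x => p x * blim x)) /\
    \int[mu]_(x in `[l, t]) (p x * (picard n).2 x) @[n --> \oo] -->
    \int[mu]_(x in `[l, t]) (p x * blim x).
  move=> ltu; apply: (@cvg_Rintegral_bounded _ _ _ _ (C * E u)).
  - by move=> n; apply: (subW _ _ ltu); exact: continuous_pb.
  - by move=> n x; exact: bound1.
  - move=> x /(sub _ _ ltu) lxu; have [_ cx] := cvg_picard lxu.
    by apply: cvgM; [exact: cvg_cst|exact: cx].
have lim2 t : l <= t <= u ->
    mu.-integrable `[l, t] (EFin \o (fun x => lam * alim x)) /\
    \int[mu]_(x in `[l, t]) (lam * (picard n).1 x) @[n --> \oo] -->
    \int[mu]_(x in `[l, t]) (lam * alim x).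
  move=> ltu; apply: (@cvg_Rintegral_bounded _ _ _ _ (C * E u)).
  - by move=> n; apply: (subW _ _ ltu); exact: continuous_la.
  - by move=> n x; exact: bound2.
  - move=> x /(sub _ _ ltu) lxu; have [cx _] := cvg_picard lxu.
    by apply: cvgM; [exact: cvg_cst|exact: cx].
have alimE t : l <= t <= u ->
    alim t = al + \int[mu]_(x in `[l, t]) (p x * blim x).
  move=> ltu; have [+ _] := cvg_picard ltu; have [_ ci] := lim1 _ ltu.
  (* Shifting the index by one exposes the integral that defines each iterate. *)
  rewrite -cvg_shiftS => ca; have ci' := cvgD (cvg_cst al) ci.
  have e1 := cvg_lim (@Rhausdorff R) ca.
  have e2 := cvg_lim (@Rhausdorff R) (ci' _ _).
  rewrite -[LHS]e1; exact: e2.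
have blimE t : l <= t <= u ->
    blim t = be + \int[mu]_(x in `[l, t]) (lam * alim x).
  move=> ltu; have [_ +] := cvg_picard ltu; have [_ ci] := lim2 _ ltu.
  rewrite -cvg_shiftS => cb; have ci' := cvgD (cvg_cst be) ci.
  have e1 := cvg_lim (@Rhausdorff R) cb.
  have e2 := cvg_lim (@Rhausdorff R) (ci' _ _).
  rewrite -[LHS]e1; exact: e2.
have lim_ge0 t : l <= t <= u -> 0 <= alim t /\ 0 <= blim t.
  move=> ltu; have [ca cb] := cvg_picard ltu.
  split; apply: limr_ge; [exact: cvgP ca| |exact: cvgP cb|];
    by apply: nearW => n; case: (picard_ge0 n ltu).
have luu : l <= u <= u by rewrite lexx ltW.
have itvE (t x : R) : l <= t <= u -> x \in `[l, t]%classic -> l <= x <= u.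
  by move=> ltu; rewrite inE /= in_itv /=; exact: sub.
(* Regularity in stages: [b] is continuous as the primitive of an integrable function; [a] and [b'],
   primitives of continuous functions, are then derivable. All agree with the limits on [l, u]. *)
pose b t := be + \int[mu]_(x in `[l, t]) (lam * alim x).
pose a t := al + \int[mu]_(x in `[l, t]) (p x * b x).
have aE t : l <= t <= u -> a t = alim t.
  move=> ltu; rewrite alimE// /a; congr (_ + _).
  by apply: eq_Rintegral => x /(itvE _ _ ltu) lxu; rewrite /b -blimE.
have cb : {within `[l, u], continuous b}.
  apply: (within_continuousD (@within_continuous_cst _ be)).
  exact: parameterized_integral_continuous (ltW lu) (lim2 _ luu).1.
have [pb0 cpb dpb] := antiderivative lu (within_continuousM cp cb).
have ca : {within `[l, u], continuous a}.
  exact: (within_continuousD (@within_continuous_cst _ al) cpb).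
have [la0 cla dla] := antiderivative lu
  (within_continuousM (@within_continuous_cst _ lam) ca).
have bE t : l <= t <= u -> b t = be + \int[mu]_(x in `[l, t]) (lam * a x).
  move=> ltu; rewrite /b; congr (_ + _).
  by apply: eq_Rintegral => x /(itvE _ _ ltu) lxu; rewrite aE.
pose b' t := be + \int[mu]_(x in `[l, t]) (lam * a x).
exists a, b'; split.
- by rewrite /a pb0 addr0.
- by rewrite /b' la0 addr0.
- exact: ca.
- exact: (within_continuousD (@within_continuous_cst _ be) cla).
- move=> t ltu; have [a0 b0] := lim_ge0 _ ltu.
  split; [by rewrite aE|by rewrite /b' -bE// /b -blimE|move=> ltu'].
  split.
    have := is_derive1D (is_derive1_cst al t) (dpb _ ltu').
    by rewrite add0r /b' -bE.
  have := is_derive1D (is_derive1_cst be t) (dla _ ltu').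
  by rewrite add0r.
Qed.

End picard.

End linear_ode.

(** * Smoothness of solutions and extension of the coefficient *)

Section smooth_ode.
Context {R : realType}.
Implicit Types (I : set R) (p a b : R -> R).

(** Bootstrap: the derivatives of [a] and [b] are multiples of p b and of [a], so both functions
    gain one order together. *)
Lemma Cn_linear_ode I p a b (lam : R) : open I -> (forall n, Cn n I p) ->
  (forall t, I t -> is_derive t 1 a (p t * b t)) ->
  (forall t, I t -> is_derive t 1 b (lam * a t)) ->
  forall n, Cn n I a /\ Cn n I b.
Proof.
move=> oI Cp da db.
have dfa x : I x -> differentiable a x.
  by move=> /da ?; apply/derivable1_diffP; exact: ex_derive.
have dfb x : I x -> differentiable b x.
  by move=> /db ?; apply/derivable1_diffP; exact: ex_derive.
elim=> [|n [Ca Cb]]; split; apply: Cn_intro; try exact: dfa; try exact: dfb;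
  move=> m [] // <- v.
- have E x : I x -> 'D_v a x = (cst v * (p * b)) x.
    by move=> /da/derive_scale1->.
  apply: Cn_eq (oI) E _; apply: CnM (oI) _ _; first exact: Cn_cst.
  exact: CnM.
- have E x : I x -> 'D_v b x = (cst v * (cst lam * a)) x.
    by move=> /db/derive_scale1->.
  apply: Cn_eq (oI) E _; apply: CnM (oI) _ _; first exact: Cn_cst.
  by apply: CnM (oI) _ _; first exact: Cn_cst.
Qed.

(** Only the local extensions at 0 and L are glued to [h]; continuity keeps them positive near the
    ends. The equation then makes sense on an open interval around [0, L]. *)
Lemma smooth_segment_extension (h : R -> R) (L : R) : 0 < L ->
  smooth_on [set t : R | 0 <= t <= L] h ->
  (forall t, 0 <= t <= L -> 0 < h t) ->
  exists (H : R -> R) (e : R),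
    [/\ 0 < e, forall n, Cn n [set t | - e < t < L + e] H,
        forall t, 0 <= t <= L -> H t = h t &
        forall t, - e < t < L + e -> 0 < H t].
Proof.
move=> L0 sh h0.
have end_nbhs x : 0 <= x <= L -> exists (F : R -> R) (e : R),
    [/\ 0 < e, forall n, Cn n [set t | x - e < t < x + e] F,
        forall t, 0 <= t <= L -> x - e < t < x + e -> h t = F t &
        forall t, x - e < t < x + e -> 0 < F t].
  move=> xL; have [U [F [oU Ux CF hF]]] := sh x xL.
  have /CinftyP CFn := CF.
  have Fx : 0 < F x by rewrite -hF//; exact: h0.
  have cF : F @ x --> F x.
    exact: differentiable_continuous (Cn_differentiable (CFn 0%N) Ux).
  have nU : nbhs x U by exact: open_nbhs_nbhs.
  have nF : \forall t \near x, 0 < F t by exact: (cvgr_gt (F x) cF).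
  have /nbhs_ballP[e e0 eU] : nbhs x (U `&` [set t | 0 < F t]).
    exact: filterI.
  have ballE t : x - e < t < x + e -> U t /\ 0 < F t.
    by move=> xt; apply: eU; rewrite /ball /= distrC ltr_distl.
  exists F, e; split=> //.
  - by move=> n; apply: CnS (CFn n) => t /ballE[].
  - by move=> t tL /ballE[Ut _]; exact: hF.
  - by move=> t /ballE[].
have L_ge0 := ltW L0.
have [] := end_nbhs 0; first by rewrite lexx.
move=> F0 [e0 [e0_gt0 CF0 hF0 F0_gt0]].
have [] := end_nbhs L; first by rewrite lexx L_ge0.
move=> FL [eL [eL_gt0 CFL hFL FL_gt0]].
(* With e <= L, the neighbourhood of 0 stays left of L and that of L stays right of 0, so each meets
   only two of the three branches of [H]. *)
pose e := Num.min L (Num.min e0 eL).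
have e_gt0 : 0 < e by rewrite !lt_min L0 e0_gt0.
have eL' : e <= L by rewrite ge_min lexx.
have ee0 : e <= e0 by rewrite !ge_min lexx orbT.
have eeL : e <= eL by rewrite !ge_min lexx !orbT.
pose H t := if t <= 0 then F0 t else if t < L then h t else FL t.
have HF0 t : - e < t < e -> H t = F0 t.
  move=> /andP[et te]; rewrite /H; case: (leP t 0) => // t0.
  case: (ltP t L) => [_|]; last by lra.
  by apply: hF0; apply/andP; split; lra.
have HFL t : L - e < t < L + e -> H t = FL t.
  move=> /andP[et te]; rewrite /H; case: (leP t 0) => [t0|t0]; first by lra.
  case: (ltP t L) => // tL; apply: hFL; apply/andP; split; lra.
have Hh t : 0 <= t <= L -> H t = h t.
  move=> /andP[t0 tL]; rewrite /H; case: (leP t 0) => [t0'|_].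
    have -> : t = 0 by apply/le_anti/andP.
    by rewrite -hF0 ?lexx//; apply/andP; split; lra.
  case: (ltP t L) => // tL'; have -> : t = L by apply/le_anti/andP.
  by rewrite -hFL ?lexx ?L_ge0//; apply/andP; split; lra.
exists H, e; split => //.
- move=> n; apply: Cn_local => x /andP[ex xe].
  have [x0|x0] := leP x 0.
    exists [set t | - e < t < e], F0; split=> //.
    + exact: open_oo.
    + by apply/andP; split; lra.
    + by apply: CnS (CF0 n) => t /andP[? ?]; apply/andP; split; lra.
  have [xL|xL] := ltP x L; last first.
    exists [set t | L - e < t < L + e], FL; split=> //.
    + exact: open_oo.
    + by apply/andP; split; lra.
    + by apply: CnS (CFL n) => t /andP[? ?]; apply/andP; split; lra.
  have [|U [F [oU Ux CF hF]]] := sh x; first by rewrite /= !ltW.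
  exists (U `&` [set t | 0 < t < L]), F; split.
  + by apply: openI => //; exact: open_oo.
  + by split=> //=; rewrite x0.
  + by apply: CnS ((CinftyP _ _).1 CF n) => t [].
  + move=> t [Ut /andP[t0 tL]]; have t0L : 0 <= t <= L by rewrite !ltW.
    by rewrite Hh//; exact: hF.
- move=> t /andP[et te]; have [t0|t0] := leP t 0.
    by rewrite HF0 ?F0_gt0//; apply/andP; split; lra.
  have [tL|tL] := ltP t L; first by rewrite Hh ?h0// !ltW.
  by rewrite HFL ?FL_gt0//; apply/andP; split; lra.
Qed.

End smooth_ode.

(** * Fundamental solutions and the choice of s *)

Section exists_mode.
Context {R : realType}.

(* Signs come from the Wronskian: for the solutions (a1, b1), (a2, b2) with data
   (1, 0), (0, 1) at the left end it makes a2 / a1 and b1 / b2 nondecreasing. *)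
Lemma fundamental_solutions (p : R -> R) (L e lam : R) : 0 < L -> 0 < e ->
  (forall n, Cn n [set t | - e < t < L + e] p) ->
  (forall t, - e < t < L + e -> 0 < p t) -> 0 <= lam ->
  exists A B P Q : R -> R, exists2 d, 0 < d &
    [/\ forall t, - d < t < L + d ->
          [/\ - e < t < L + e, is_derive t 1 A (p t * B t),
              is_derive t 1 B (lam * A t), is_derive t 1 P (p t * Q t) &
              is_derive t 1 Q (lam * P t)],
        [/\ A 0 = 1, B 0 = 0, P 0 = 0 & Q 0 = 1],
        forall t, - d < t < L + d -> A t * Q t - B t * P t = 1,
        forall t, 0 <= t <= L -> 0 < A t &
        [/\ forall t, 0 <= t <= L -> 0 <= P t & 0 < P L] ].
Proof.
move=> L0 e0 Cp p_gt0 lam0.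
(* Halving keeps the closed interval [l, u] inside the open one where [p] is smooth, and 0 and L
   interior to it. *)
pose d := e / 2; have d0 : 0 < d by rewrite divr_gt0.
pose l := - d; pose u := L + d.
have de : d < e by rewrite /d; lra.
have lu : l < u by rewrite /l /u; lra.
have luI t : l <= t <= u -> - e < t < L + e.
  by move=> /andP[]; rewrite /l /u => ? ?; apply/andP; split; lra.
have cp : {within `[l, u], continuous p}.
  apply: derivable_within_continuous => t; rewrite in_itv /= => /luI It.
  exact: (Cn_derivable (Cp 0%N) It).
have [m mlu pm] := EVT_max (ltW lu) cp.
pose C := Num.max (p m) lam.
have pC t : l <= t <= u -> 0 <= p t <= C.
  move=> ltu; rewrite ltW ?p_gt0 ?luI//= le_max pm ?in_itv//.
have lamC : 0 <= lam <= C by rewrite lam0 le_max lexx orbT.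
have [a1 [b1 [a1l b1l ca1 cb1 ode1]]] :=
  linear_ode lu cp pC lamC ler01 (lexx 0).
have [a2 [b2 [a2l b2l ca2 cb2 ode2]]] :=
  linear_ode lu cp pC lamC (lexx 0) ler01.
have ltl t : l < t < u -> l <= t <= u by move=> /andP[? ?]; rewrite !ltW.
have d1 t : l < t < u -> is_derive t 1 a1 (p t * b1 t) /\
    is_derive t 1 b1 (lam * a1 t).
  by move=> ltu; have [_ _] := ode1 _ (ltl _ ltu); apply.
have d2 t : l < t < u -> is_derive t 1 a2 (p t * b2 t) /\
    is_derive t 1 b2 (lam * a2 t).
  by move=> ltu; have [_ _] := ode2 _ (ltl _ ltu); apply.
pose W t := a1 t * b2 t + - (b1 t * a2 t).
have cW : {within `[l, u], continuous W}.
  have cab := within_continuousM ca1 cb2.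
  have cba := within_continuousM cb1 ca2.
  exact: (within_continuousB cab cba).
have cst1 c : {within `[l, u], continuous (fun=> c : R)}.
  exact: within_continuous_cst.
have dW t : l < t < u -> is_derive t 1 W 0.
  move=> ltu; have [da1 db1] := d1 _ ltu; have [da2 db2] := d2 _ ltu.
  by rewrite /W; is_derive1_eq; ring.
have Wl : W l = 1 by rewrite /W a1l b1l b2l mulr1 mul0r subr0.
have W1 t : l <= t <= u -> W t = 1.
  move=> ltu; apply/le_anti/andP; split.
    apply: (le_of_is_derive (f' := fun=> 0) (g' := fun=> 0)
      cW (cst1 1) _ _ ltu).
      by move=> s lsu; split; [exact: dW|exact: is_derive1_cst|].
    by rewrite Wl.
  apply: (le_of_is_derive (f' := fun=> 0) (g' := fun=> 0) (cst1 1) cW _ _ ltu).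
    by move=> s lsu; split; [exact: is_derive1_cst|exact: dW|].
  by rewrite Wl.
have a1_gt0 t : l <= t <= u -> 0 < a1 t.
  move=> ltu; apply: (lt_le_trans ltr01).
  apply: (le_of_is_derive (f' := fun=> 0) (g' := fun t => p t * b1 t)
    (cst1 1) ca1 _ _ ltu).
    move=> s lsu; split; [exact: is_derive1_cst|by case: (d1 _ lsu)|].
    have [_ b1s _] := ode1 _ (ltl _ lsu); have /andP[p0 _] := pC _ (ltl _ lsu).
    exact: mulr_ge0.
  by rewrite a1l.
have b2_gt0 t : l <= t <= u -> 0 < b2 t.
  move=> ltu; apply: (lt_le_trans ltr01).
  apply: (le_of_is_derive (f' := fun=> 0) (g' := fun t => lam * a2 t)
    (cst1 1) cb2 _ _ ltu).
    move=> s lsu; split; [exact: is_derive1_cst|by case: (d2 _ lsu)|].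
    have [a2s _ _] := ode2 _ (ltl _ lsu).
    exact: mulr_ge0.
  by rewrite b2l.
(* As [W 0 = 1], these combinations are the fundamental solutions with data (1, 0) and (0, 1) moved
   from l to 0. *)
pose A t := b2 0 * a1 t + - (b1 0 * a2 t).
pose B t := b2 0 * b1 t + - (b1 0 * b2 t).
pose P t := a1 0 * a2 t + - (a2 0 * a1 t).
pose Q t := a1 0 * b2 t + - (a2 0 * b1 t).
have lu0 : l < 0 < u by rewrite /l /u; apply/andP; split; lra.
have W0 := W1 _ (ltl _ lu0).
have luL t : 0 <= t <= L -> l < t < u.
  by rewrite /l /u => /andP[? ?]; apply/andP; split; lra.
have dA t : l < t < u -> is_derive t 1 A (p t * B t).
  move=> ltu; have [da1 db1] := d1 _ ltu; have [da2 db2] := d2 _ ltu.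
  by rewrite /A /B; is_derive1_eq; ring.
(* [B t] is [b2 0 * b2 t] times the increment of b1 / b2 from 0 to t; likewise for [P] below, with
   a2 / a1. *)
have B_ge0 t : 0 <= t <= L -> 0 <= B t.
  move=> /andP[t0 tL].
  have : b1 0 / b2 0 <= b1 t / b2 t.
    apply: (@ler_is_derive _ (fun s => b1 s * (b2 s)^-1)
      (fun s => lam * W s / b2 s ^+ 2)) => [|s /andP[s0 st]|s /andP[s0 st]].
    - exact: t0.
    - have ltu : l < s < u by apply: luL; rewrite s0 (le_trans st).
      have [da1 db1] := d1 _ ltu; have [da2 db2] := d2 _ ltu.
      have bn := lt0r_neq0 (b2_gt0 _ (ltl _ ltu)).
      by rewrite /W; is_derive1_eq; [|field].
    - have ltu : l < s < u by apply: luL; rewrite s0 (le_trans st).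
      by rewrite W1 ?ltl// mulr1 divr_ge0 ?sqr_ge0.
  have b20 := b2_gt0 _ (ltl _ lu0).
  have b2t := b2_gt0 t (ltl _ (luL t (introT andP (conj t0 tL)))).
  rewrite ler_pdivrMr// mulrAC ler_pdivlMr// /B => ?.
  by rewrite subr_ge0 [b2 0 * _]mulrC.
have P_lt t1 t2 : 0 <= t1 -> t1 < t2 -> t2 <= L ->
    a2 t1 / a1 t1 < a2 t2 / a1 t2.
  move=> t10 t12 t2L.
  apply: (@ltr_is_derive _ (fun s => a2 s * (a1 s)^-1)
    (fun s => p s * W s / a1 s ^+ 2)) => [|s /andP[s0 st]|s /andP[s0 st]].
  - exact: t12.
  - have ltu : l < s < u.
      by apply: luL; rewrite (le_trans t10)//= (le_trans st).
    have [da1 db1] := d1 _ ltu; have [da2 db2] := d2 _ ltu.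
    have an := lt0r_neq0 (a1_gt0 _ (ltl _ ltu)).
    by rewrite /W; is_derive1_eq; [|field].
  - have ltu : l < s < u.
      by apply: luL; rewrite (le_trans t10)//= (le_trans st).
    rewrite W1 ?ltl// mulr1 divr_gt0 ?exprn_gt0 ?a1_gt0 ?ltl//.
    by apply/p_gt0/luI/ltl.
have P_gt0 t : 0 < t -> t <= L -> 0 < P t.
  move=> t0 tL; have := P_lt 0 t (lexx 0) t0 tL.
  have a10 := a1_gt0 _ (ltl _ lu0).
  have a1t := a1_gt0 t (ltl _ (luL t (introT andP (conj (ltW t0) tL)))).
  rewrite ltr_pdivrMr// mulrAC ltr_pdivlMr// /P => ?.
  by rewrite subr_gt0 [a1 0 * _]mulrC.
exists A, B, P, Q, d; first exact: d0.
have A0 : A 0 = 1 by rewrite -W0 /A /W; ring.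
split.
- move=> t ltu; have [da1 db1] := d1 _ ltu; have [da2 db2] := d2 _ ltu.
  split; [exact/luI/ltl|exact: dA|..].
  + by rewrite /A /B; is_derive1_eq; ring.
  + by rewrite /P /Q; is_derive1_eq; ring.
  + by rewrite /P /Q; is_derive1_eq; ring.
- split=> //; first by rewrite /B; ring.
    by rewrite /P; ring.
  by rewrite -W0 /Q /W; ring.
(* The new Wronskian is the product [W 0 * W t]. *)
- move=> t ltu; rewrite -[RHS]mulr1 -{1}W0 -(W1 _ (ltl _ ltu)).
  by rewrite /A /B /P /Q /W; ring.
- move=> t /andP[t0 tL]; rewrite (lt_le_trans ltr01)// -A0.
  apply: (@ler_is_derive _ A (fun s => p s * B s)) =>
    [|s /andP[s0 st]|s /andP[s0 st]].
  + exact: t0.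
  + by apply/dA/luL; rewrite s0 (le_trans st).
  + have s0L : 0 <= s <= L by rewrite s0 (le_trans st).
    by rewrite mulr_ge0 ?B_ge0// ltW// p_gt0// luI// ltl// luL.
- split; last exact: P_gt0.
  move=> t /andP[]; rewrite le_eqVlt => /predU1P[<- _|t0 tL].
    by rewrite /P mulrC subrr.
  by rewrite ltW// P_gt0.
Qed.

(** Shooting from 0: a = A - s P and b = B - s Q satisfy the condition at 0 for every s. The
    condition at L is the quadratic equation P s^2 - (A + Q) s + B = 0, with coefficients taken at
    L. *)
Lemma exists_positive_mode (h : R -> R) (L lam : R) : 0 < L ->
  smooth_on [set t : R | 0 <= t <= L] h ->
  (forall t, 0 <= t <= L -> 0 < h t) -> 0 <= lam ->
  exists (s : R) (a b : R -> R) (I : set R),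
    [/\ open I, forall t, 0 <= t <= L -> I t, Cinfty I a &
        positive_mode h L lam s a b].
Proof.
move=> L0 sh h0 lam0.
have [H [e [e0 CH Hh H0]]] := smooth_segment_extension L0 sh h0.
pose p t := (H t * H t)^-1.
have Cp n : Cn n [set t | - e < t < L + e] p.
  apply: CnV; first exact: open_oo.
    by move=> t /H0 Ht; rewrite mulf_neq0 ?gt_eqF.
  by apply: CnM (CH n) (CH n); exact: open_oo.
have p0 t : - e < t < L + e -> 0 < p t.
  by move=> /H0 Ht; rewrite invr_gt0 mulr_gt0.
have [A [B [P [Q [d d0 [ode [A0 B0 P0 Q0] W A_gt0 [P_ge0 PL]]]]]]] :=
  fundamental_solutions L0 e0 Cp p0 lam0.
have Ld t : 0 <= t <= L -> - d < t < L + d.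
  by move=> /andP[? ?]; apply/andP; split; lra.
have LL : 0 <= L <= L by rewrite lexx ltW.
have WL := W L (Ld _ LL).
(* The discriminant (A + Q)^2 - 4 P B takes this form because A Q - B P = 1. *)
pose r := Num.sqrt ((A L - Q L) ^+ 2 + 4).
have r2 : r ^+ 2 = (A L - Q L) ^+ 2 + 4.
  by rewrite sqr_sqrtr// addr_ge0 ?sqr_ge0.
pose s := (A L + Q L - r) / (2 * P L).
have Pn := lt0r_neq0 PL.
(* The choice of the lower root matters here: r exceeds the absolute value of A - Q at L. *)
have aL_gt0 : 0 < A L - s * P L.
  have -> : A L - s * P L = (A L - Q L + r) / 2 by rewrite /s; field.
  rewrite divr_gt0// -[A L - Q L]opprK addrC subr_gt0.
  rewrite (le_lt_trans (ler_norm _))// normrN -sqrtr_sqr /r ltr_sqrt ?ltrDl//.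
  by rewrite ltr_wpDl ?sqr_ge0.
pose a t := A t + - (s * P t); pose b t := B t + - (s * Q t).
exists s, a, b, [set t | - d < t < L + d].
have da t : - d < t < L + d -> is_derive t 1 a (p t * b t).
  move=> /ode[_ dA dB dP dQ].
  by rewrite /a /b; is_derive1_eq; ring.
have db t : - d < t < L + d -> is_derive t 1 b (lam * a t).
  move=> /ode[_ dA dB dP dQ].
  by rewrite /a /b; is_derive1_eq; ring.
split.
- exact: open_oo.
- exact: Ld.
- apply/CinftyP => n.
  have Cpd m : Cn m [set t | - d < t < L + d] p.
    by apply: CnS (Cp m) => t /ode[].
  by have [] := Cn_linear_ode (@open_oo R _ _) Cpd da db n.
split.
- move=> t tL; have tLd := Ld _ tL; split.
  + exact: h0.
  + have At := A_gt0 _ tL; have [s0|s0] := leP s 0.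
      by rewrite /a ltr_pwDl// oppr_ge0 mulr_le0_ge0// P_ge0.
    (* The derivative of P / A is p / A^2, again by the Wronskian. For s > 0, positivity of A - s P
       at L thus propagates to [0, L]. *)
    have PA : P t / A t <= P L / A L.
      case/andP: (tL) => t0 tL'.
      apply: (@ler_is_derive _ (fun x => P x * (A x)^-1)
        (fun x => p x * (A x * Q x - B x * P x) / A x ^+ 2)) =>
        [|x /andP[tx xL]|x /andP[tx xL]].
      * exact: tL'.
      * have xL' : 0 <= x <= L by rewrite (le_trans t0).
        have [_ dA dB dP dQ] := ode _ (Ld _ xL').
        have An := lt0r_neq0 (A_gt0 _ xL').
        by is_derive1_eq; [|field].
      * have xL' : 0 <= x <= L by rewrite (le_trans t0).
        have [xe _ _ _ _] := ode _ (Ld _ xL').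
        by rewrite W ?Ld// mulr1 divr_ge0 ?sqr_ge0// ltW// p0.
    have AL := A_gt0 _ LL.
    have sPA : s * (P L / A L) < 1.
      by rewrite mulrA ltr_pdivrMr// mul1r -subr_gt0.
    rewrite /a subr_gt0 -[ltRHS]mul1r -ltr_pdivrMr// -mulrA.
    by rewrite (le_lt_trans _ sPA)// ler_wpM2l// ltW.
  + have := da _ tLd; rewrite /p (Hh _ tL) => dat.
    by rewrite expr2 mulrC.
  + exact: db.
- by rewrite /b /a B0 Q0 A0 P0 !mulr1 mulr0 subr0 sub0r mulr1.
- apply/eqP; rewrite -subr_eq0 /b /a.
  have -> : B L - s * Q L - s * (A L - s * P L) =
      (4 * (P L * B L) + r ^+ 2 - (A L + Q L) ^+ 2) / (4 * P L).
    by rewrite /s; field.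
  rewrite mulf_eq0; apply/orP; left; rewrite r2.
  have -> : P L * B L = A L * Q L - 1 by rewrite -WL; ring.
  by apply/eqP; ring.
Qed.

End exists_mode.

(** * Comparison of the two spectra *)

Unset Implicit Arguments.
Set Strict Implicit.

Theorem theorem3p1 (R : realType) (Sigma : riemannianManifold R 2)
  (Sigma_compact : compact [set: Sigma]) (Sigma_connected : connected [set: Sigma])
  (area : {measure set (g_sigma_algebraType (@open Sigma)) -> \bar R})
  (area_riem : is_area area) (area1 : area [set: Sigma] = 1%E)
  (L : R) (L_gt0 : 0 < L)
  (h : R -> R) (h_smooth : smooth_on [set t : R | 0 <= t <= L] h)
  (h_gt0 : forall t, 0 <= t <= L -> 0 < h t) (h0 : h 0 = 1) (hL : h L = 1)
  (sigma : nat -> R) (sigma_spec : steklov_spectrum Sigma L h sigma)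
  (lambda : nat -> R) (lambda_spec : laplace_spectrum Sigma lambda)
  (L1 L2 c : R) (L1_gt0 : 0 < L1) (L1_lt_L2 : L1 < L2) (L2_lt_L : L2 < L)
  (c_gt0 : 0 < c) (h_le_c : forall t, L1 <= t <= L2 -> h t <= c)
  (j : nat) (j_ge1 : (1 <= j)%N) :
  sigma j <= lambda j * L / 2 -
    Num.min (lambda j * (L2 - L1) / 4)
      (3 * lambda j ^+ 2 * (L2 - L1) ^+ 3 /
         (8 * (12 * c ^+ 2 + lambda j * (L2 - L1) ^+ 2))).
Proof.
have /choice[F HF] lam : exists s : R, 0 <= lam ->
    exists (a b : R -> R) (I : set R), [/\ open I, forall t, 0 <= t <= L -> I t,
      Cinfty I a & positive_mode h L lam s a b].
  (* [F] must be total; its value at negative arguments is arbitrary. *)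
  have [lam0|] := boolP (0 <= lam); last by exists 0.
  have [s [a [b [I mode]]]] := exists_positive_mode L_gt0 h_smooth h_gt0 lam0.
  by exists s => _; exists a, b, I.
have [lambda0 _ lambda_homo _ _] := lambda_spec.
have lambda_ge0 k : 0 <= lambda k by rewrite -lambda0; exact: lambda_homo.
apply: (eigenvalues_of_le (F := F) lambda_spec sigma_spec).
- move=> x y; rewrite !inE => x0 y0 Fxy.
  have [a [b [I [_ _ _ mx]]]] := HF x x0.
  have [a' [b' [I' [_ _ _ my]]]] := HF y y0.
  by rewrite -Fxy in my; exact: (mode_inj L_gt0 mx my).
- move=> x m n x0 dimm dimn.
  have [a [b [I [oI LI Ca mode]]]] := HF x x0.
  have [ode b0 bL] := mode.
  apply: (has_dim_le (Phi := fun f q => a q.1 * f q.2) dimm dimn).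
    move=> f; apply: (steklov_separated L_gt0 h0 hL oI LI Ca _ b0 bL).
    by move=> t /ode[ht at0 da db]; split; rewrite ?gt_eqF.
  move=> k coef f sum0 p _.
  have L0 : (0 : R) <= 0 <= L by rewrite lexx ltW.
  have [_ a0 _ _] := ode _ L0.
  (* Multiplication by [a] preserves linear independence: restrict to t = 0 and divide by [a 0],
     which is positive. *)
  have := sum0 (0, p) L0; under eq_bigr do rewrite /= mulrCA.
  by rewrite -big_distrr => /eqP; rewrite mulf_eq0 gt_eqF//= => /eqP.
- move=> k kj; have [a [b [I [_ _ _ mode]]]] := HF _ (lambda_ge0 k).
  (* Here [mu] is [lambda j], and the minimum is at most its second term. *)
  apply: le_trans (mode_bound L1_gt0 L1_lt_L2 L2_lt_L c_gt0 h_le_c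
    (lambda_ge0 k) (lambda_homo _ _ kj) mode) _.
  by rewrite lerD2l lerN2 ge_min lexx orbT.
Qed.
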